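(* Let $\mathbb K$ be a field of characteristic $0$ and $x\in\mathbb K$. The Hopf subalgebra $\mathcal E_Y$ of $\mathcal H_D$ spanned by disjoint unions (products) of path trees is isomorphic, as a Hopf algebra, to $\mathrm{Sym}$, the Hopf algebra of coordinates on the group of formal power series with constant term $1$ under multiplication.
   Context: Dissection diagrams. For $n\ge 0$ let $\Pi_n$ be the regular $(n+1)$-gon with vertices $0,1,\dots,n$ numbered clockwise; vertex $0$ is the root. For $0\le i\le n$, side $i$ goes from vertex $i$ to vertex $i+1$ (with $n+1$ read as $0$). A chord is a segment joining two distinct vertices (adjacent vertices are allowed; such a chord is distinct from the side). A dissection diagram of degree $n$ is a set of $n$ pairwise non-crossing chords (they may share endpoints) of $\Pi_n$ forming an acyclic graph, hence a spanning tree on $\{0,\dots,n\}$. All chords are oriented towards the root. $\mathrm{Ch}(D)$ is the set of chords of $D$. The diagram of degree $0$ is identified with $1$. Coproduct. $\mathcal H_D$ is the commutative polynomial algebra on dissection diagrams of positive degree, with $\Delta(D)=\sum_{C\subset \mathrm{Ch}(D)}x^{k_C(D)}q_C(D)\otimes r_C(D)$ (with $x^0=1$), extended multiplicatively; it is a graded connected Hopf algebra. Here the $p=|C|$ chords of $C$ cut the polygon into $p+1$ faces; for a face $\alpha$ let $S_C(\alpha)$ be the (nonempty) set of sides of the polygon bordering $\alpha$. $q_C(D)$ is obtained by contracting every chord of $C$ to a point: each face $\alpha$ becomes a polygon with set of sides $S_C(\alpha)$, rooted at the starting vertex of its side of minimal label, carrying the chords of $D$ not in $C$ that lie in $\alpha$;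 this is a dissection diagram, and $q_C(D)$ is the product of these over all faces. $r_C(D)$ is the dissection diagram of degree $p$ obtained by keeping the chords of $C$ and contracting all sides which are not the minimal side of their face, the root being the image of $0$. $k_C(D)$ is the number of chords of $C$ whose orientation in $D$ is opposite to their orientation (towards the root) in $r_C(D)$. Path trees. $Y_0=1$, and for $n\ge1$ the path tree $Y_n$ is the dissection diagram of degree $n$ with chords $1\to2,\ 2\to3,\dots,(n-1)\to n,\ n\to0$. One has $\Delta(Y_n)=\sum_{k=0}^n\binom nk Y_k\otimes Y_{n-k}$, so $\mathcal E_Y$ is a Hopf subalgebra. $\mathrm{Sym}$. Let $G_0=\{1+\sum_{n\ge1}q_nh^n\in\mathbb K[[h]]\}$ with multiplication of series, and let $\Sigma_n:G_0\to\mathbb K$ be the coordinate map $1+\sum_m q_mh^m\mapsto q_n$. $\mathrm{Sym}=\mathbb K[\Sigma_1,\Sigma_2,\dots]$ with its usual product and the coproduct determined by $\Delta_{G_0}(f)(P\otimes Q)=f(PQ)$ for $f\in\mathrm{Sym}$, $P,Q\in G_0$. *)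

(* Defs.v *)
From HB Require Import structures.
From mathcomp Require Import all_boot all_algebra.
From mathcomp Require Import finmap.
From mathcomp.multinomials Require Import monalg.
From mathcomp.classical Require Import boolp.

Set Implicit Arguments.
Unset Strict Implicit.
Unset Printing Implicit Defensive.

Import GRing.Theory.

Local Open Scope fset_scope.
Local Open Scope quotient_scope.
Local Open Scope ring_scope.

(* The tensor product of U and V: finite formal sums of pairs (u, v), identified
   when no bilinear map tells them apart. *)

Definition bilin (K : fieldType) (U V W : lmodType K) (B : U -> V -> W) : Prop :=
  (forall v, linear (B^~ v)) /\ (forall u, linear (B u)).

Section TensorQuotient.
Variables (K : fieldType) (U V : lmodType K).

Definition tsum (W : lmodType K) (B : U -> V -> W) (s : seq (U * V)) : W :=
  \sum_(p <- s) B p.1 p.2.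

Definition tens_eq : rel (seq (U * V)) := fun s t =>
  `[< forall (W : lmodType K) (B : U -> V -> W), bilin B -> tsum B s = tsum B t >].

Lemma tens_eq_equiv : equiv_class_of tens_eq.
Proof.
split.
- by move=> s; apply/asboolP.
- by move=> s t; apply/asboolP/asboolP => h W B /h.
- move=> t s r /asboolP h1 /asboolP h2; apply/asboolP => W B hB.
  by rewrite h1 ?h2.
Qed.

Canonical tens_equiv := EquivRelPack tens_eq_equiv.

Definition tensor := {eq_quot tens_eq}.
HB.instance Definition _ := Choice.on tensor.
HB.instance Definition _ := Quotient.on tensor.

Definition tens (u : U) (v : V) : tensor := \pi_tensor [:: (u, v)].

(* The map sending tens u v to B u v; it is meaningful for bilinear B. *)
Definition tlift (W : lmodType K) (B : U -> V -> W) (x : tensor) : W :=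
  tsum B (repr x).

Lemma tlift_pi (W : lmodType K) (B : U -> V -> W) s :
  bilin B -> tlift B (\pi_tensor s) = tsum B s.
Proof.
move=> hB; rewrite /tlift.
have /eqmodP/asboolP h : repr (\pi_tensor s) = s %[mod tensor] by rewrite reprK.
exact: h.
Qed.

Lemma tensorP (x y : tensor) :
  (forall (W : lmodType K) (B : U -> V -> W), bilin B -> tlift B x = tlift B y)
  -> x = y.
Proof.
move=> h; rewrite -(reprK x) -(reprK y); apply/eqmodP/asboolP => W B hB.
exact: h.
Qed.

Lemma tlift_tens (W : lmodType K) (B : U -> V -> W) u v :
  bilin B -> tlift B (tens u v) = B u v.
Proof. by move=> hB; rewrite tlift_pi // /tsum big_seq1. Qed.

Definition tens0 : tensor := \pi_tensor [::].
Definition tens_add (x y : tensor) : tensor := \pi_tensor (repr x ++ repr y).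
Definition tens_scale (a : K) (x : tensor) : tensor :=
  \pi_tensor [seq (a *: p.1, p.2) | p <- repr x].
Definition tens_opp (x : tensor) : tensor := tens_scale (-1) x.

Section Tlift.
Variables (W : lmodType K) (B : U -> V -> W).
Hypothesis hB : bilin B.

Lemma bilinZl a u v : B (a *: u) v = a *: B u v.
Proof.
have h0 : B 0 v = 0.
  have := hB.1 v 1 0 0; rewrite !scale1r addr0 => /eqP.
  by rewrite -subr_eq0 opprD addrA subrr sub0r oppr_eq0 => /eqP.
by have := hB.1 v a u 0; rewrite /= !addr0 h0 addr0.
Qed.

Lemma tlift0_def : tlift B tens0 = 0.
Proof. by rewrite tlift_pi // /tsum big_nil. Qed.

Lemma tliftD_def x y : tlift B (tens_add x y) = tlift B x + tlift B y.
Proof. by rewrite tlift_pi // /tsum big_cat. Qed.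

Lemma tliftZ_def a x : tlift B (tens_scale a x) = a *: tlift B x.
Proof.
rewrite tlift_pi // /tlift /tsum big_map scaler_sumr.
by apply: eq_bigr => p _; rewrite bilinZl.
Qed.

End Tlift.

Lemma tens_addA : associative tens_add.
Proof. by move=> x y z; apply: tensorP => W B h; rewrite !tliftD_def // addrA. Qed.
Lemma tens_addC : commutative tens_add.
Proof. by move=> x y; apply: tensorP => W B h; rewrite !tliftD_def // addrC. Qed.
Lemma tens_add0 : left_id tens0 tens_add.
Proof.
by move=> x; apply: tensorP => W B h; rewrite tliftD_def // tlift0_def // add0r.
Qed.
Lemma tens_addN : left_inverse tens0 tens_opp tens_add.
Proof.
move=> x; apply: tensorP => W B h.
by rewrite tliftD_def // tliftZ_def // tlift0_def // scaleN1r addNr.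
Qed.

HB.instance Definition _ :=
  GRing.isZmodule.Build tensor tens_addA tens_addC tens_add0 tens_addN.

Lemma tens_scaleA a b x : tens_scale a (tens_scale b x) = tens_scale (a * b) x.
Proof. by apply: tensorP => W B h; rewrite !tliftZ_def // scalerA. Qed.
Lemma tens_scale1 : left_id 1 tens_scale.
Proof. by move=> x; apply: tensorP => W B h; rewrite tliftZ_def // scale1r. Qed.
Lemma tens_scaleDr : right_distributive tens_scale +%R.
Proof.
move=> a x y; apply: tensorP => W B h.
by rewrite tliftZ_def // !tliftD_def // !tliftZ_def // scalerDr.
Qed.
Lemma tens_scaleDl x : {morph tens_scale^~ x : a b / a + b}.
Proof.
move=> a b; apply: tensorP => W B h.
by rewrite tliftD_def // !tliftZ_def // scalerDl.
Qed.

HB.instance Definition _ := GRing.Zmodule_isLmodule.Build K tensor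
  tens_scaleA tens_scale1 tens_scaleDr tens_scaleDl.

Lemma tlift_linear (W : lmodType K) (B : U -> V -> W) :
  bilin B -> linear (tlift B).
Proof. by move=> h a x y; rewrite tliftD_def // tliftZ_def. Qed.

Lemma tens_bilin : bilin tens.
Proof.
split=> [v a u u' | u a v v']; apply: tensorP => W B h;
  rewrite tlift_linear // !tlift_tens //; [exact: h.1 | exact: h.2].
Qed.

End TensorQuotient.

Arguments tens {K U V}.

Section TensorAlgebra.
Variables (K : fieldType) (A B : comAlgType K).
Local Notation T := (tensor A B).

Definition tens_one : T := tens 1 1.
Definition tens_mul (x y : T) : T :=
  \pi_T [seq (p.1 * q.1, p.2 * q.2) | p <- repr x, q <- repr y].

Section TliftM.
Variables (W : lmodType K) (F : A -> B -> W).
Hypothesis hF : bilin F.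

Lemma tliftM_def x y : tlift F (tens_mul x y) =
  tlift (fun a b => tlift (fun c d => F (a * c) (b * d)) y) x.
Proof. by rewrite tlift_pi // /tsum big_allpairs_dep. Qed.

Lemma bilin_mull a b : bilin (fun c d => F (a * c) (b * d)).
Proof.
split=> [d k c c' | c k d d'] /=; rewrite mulrDr -scalerAr;
  [exact: hF.1 | exact: hF.2].
Qed.

Lemma bilin_mulr c d : bilin (fun a b => F (a * c) (b * d)).
Proof.
split=> [b k a a' | a k b b'] /=; rewrite mulrDl -scalerAl;
  [exact: hF.1 | exact: hF.2].
Qed.

Lemma bilin_tlift_mul y :
  bilin (fun a b => tlift (fun c d => F (a * c) (b * d)) y).
Proof.
split=> [b k a a' | a k b b'] /=; rewrite /tlift /tsum scaler_sumr -big_split;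
  apply: eq_bigr => p _ /=;
  [exact: (bilin_mulr p.1 p.2).1 | exact: (bilin_mulr p.1 p.2).2].
Qed.

End TliftM.

Lemma tlift_exchange (W : lmodType K) (G : A -> B -> A -> B -> W) (x y : T) :
  tlift (fun a b => tlift (fun c d => G a b c d) y) x =
  tlift (fun c d => tlift (fun a b => G a b c d) x) y.
Proof. by rewrite /tlift /tsum exchange_big. Qed.

Lemma eq_tlift (U V W : lmodType K) (F G : U -> V -> W) x :
  (forall a b, F a b = G a b) -> tlift F x = tlift G x.
Proof. by move=> h; rewrite /tlift /tsum; apply: eq_bigr => p _; rewrite h. Qed.

Lemma tens_mulC : commutative tens_mul.
Proof.
move=> x y; apply: tensorP => W F hF; rewrite !tliftM_def // tlift_exchange.
by apply: eq_tlift => a b; apply: eq_tlift => c d; rewrite mulrC (mulrC d).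
Qed.

Lemma tens_mulA : associative tens_mul.
Proof.
move=> x y z; apply: tensorP => W F hF; rewrite !tliftM_def //; last first.
  exact: bilin_tlift_mul.
apply: eq_tlift => a b; rewrite tliftM_def; last exact: bilin_mull.
apply: eq_tlift => c d; apply: eq_tlift => e f.
by rewrite !mulrA.
Qed.

Lemma tens_mul1 : left_id tens_one tens_mul.
Proof.
move=> x; apply: tensorP => W F hF; rewrite tliftM_def // tlift_tens; last first.
  exact: bilin_tlift_mul.
by apply: eq_tlift => a b; rewrite !mul1r.
Qed.

Lemma tens_mulDl : left_distributive tens_mul +%R.
Proof.
move=> x y z; apply: tensorP => W F hF.
rewrite tliftM_def // tliftD_def; last exact: bilin_tlift_mul.
by rewrite tliftD_def // !tliftM_def.
Qed.

(* 0 != 1 is not asserted here, hence a comPzRingType and not an algebra; the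
   rule a *: (x * y) = (a *: x) * y is tens_scaleAl. *)
HB.instance Definition _ := GRing.Zmodule_isComPzRing.Build T
  tens_mulA tens_mulC tens_mul1 tens_mulDl.

Lemma tens_scaleAl (a : K) (x y : T) : a *: (x * y) = (a *: x) * y.
Proof.
apply: tensorP => W F hF; rewrite tliftZ_def // !tliftM_def // tliftZ_def //.
exact: bilin_tlift_mul.
Qed.

Lemma tensM (a c : A) (b d : B) : tens a b * tens c d = tens (a * c) (b * d) :> T.
Proof.
apply: tensorP => W F hF; rewrite tliftM_def // !tlift_tens //.
  exact: bilin_mull.
exact: bilin_tlift_mul.
Qed.

End TensorAlgebra.

Definition tmap (K : fieldType) (U V U' V' : lmodType K)
    (f : U -> U') (g : V -> V') : tensor U V -> tensor U' V' :=
  tlift (fun u v => tens (f u) (g v)).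

Definition tassoc (K : fieldType) (U V W : lmodType K) :
    tensor (tensor U V) W -> tensor U (tensor V W) :=
  tlift (fun t w => tlift (fun u v => tens u (tens v w)) t).

Definition is_antipode (K : fieldType) (A : comAlgType K)
    (Delta : A -> tensor A A) (eps : A -> K) (S : A -> A) : Prop :=
  [/\ linear S,
      forall a, tlift (fun u v => S u * v) (Delta a) = (eps a)%:A
    & forall a, tlift (fun u v => u * S v) (Delta a) = (eps a)%:A].

Record hopfAlgebra (K : fieldType) (A : comAlgType K) := HopfAlgebra {
  comul : A -> tensor A A;
  counit : A -> K;
  antipode : A -> A;
  comul_linear : linear comul;
  comul_monoid : monoid_morphism comul;
  counit_scalar : scalar counit;
  counit_monoid : monoid_morphism counit;
  coassoc : forall a, tassoc (tmap comul id (comul a)) = tmap id comul (comul a);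
  counitl : forall a, tlift (fun u v => counit u *: v) (comul a) = a;
  counitr : forall a, tlift (fun u v => counit v *: u) (comul a) = a;
  antipodeP : is_antipode comul counit antipode
}.

Definition hopf_morphism (K : fieldType) (A B : comAlgType K)
    (HA : hopfAlgebra A) (HB : hopfAlgebra B) (phi : {lrmorphism A -> B}) : Prop :=
  [/\ forall a, comul HB (phi a) = tmap phi phi (comul HA a),
      forall a, counit HB (phi a) = counit HA a
    & forall a, antipode HB (phi a) = phi (antipode HA a)].

Definition hopf_isomorphic (K : fieldType) (A B : comAlgType K)
    (HA : hopfAlgebra A) (HB : hopfAlgebra B) : Prop :=
  exists2 phi : {lrmorphism A -> B}, bijective phi & hopf_morphism HA HB phi.

(* The polynomial algebra over K on the variables I is {malg K[{cmonom I}]};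
   peval c h is the ring morphism extending c on K and sending the variable i
   to h i. *)
Definition pvar (K : fieldType) (I : choiceType) (i : I) : {malg K[{cmonom I}]} :=
  << ucm i >>.

Definition peval (K : fieldType) (I : choiceType) (B : comPzRingType)
    (c : K -> B) (h : I -> B) (f : {malg K[{cmonom I}]}) : B :=
  \sum_(m <- msupp f) c f@_m * \prod_(i <- finsupp m) h i ^+ m i.

(* A diagram of degree n is given by its set of n chords; the chord joining the
   vertices i < j is the pair (i, j). The degree is the number of chords, so the
   polygon (vertices and sides 0, .., n) is determined by the set. *)
Notation chord := (nat * nat)%type.
Notation chords := {fset nat * nat}.

Definition crossing (c d : chord) : bool :=
  [&& c.1 < d.1, d.1 < c.2 & c.2 < d.2]%N.

Definition adj (D : chords) : rel nat :=
  fun i j => ((i, j) \in D) || ((j, i) \in D).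

Definition acyclic (D : chords) : Prop :=
  forall s : seq nat, uniq s -> (2 < size s)%N -> ~~ cycle (adj D) s.

Definition dissection (D : chords) : Prop :=
  [/\ forall c, c \in D -> (c.1 < c.2 <= #|` D|)%N,
      forall c d, c \in D -> d \in D -> ~~ crossing c d
    & acyclic D].

(* The empty set of chords, of degree 0, is excluded: it is identified with 1. *)
Definition diagram := {D : chords | `[< dissection D >] && (D != fset0)}.
HB.instance Definition _ := Choice.on diagram.

(* The chord {a, b} of the tree D is oriented from a to b when the path of D
   from a to the root 0 starts with this chord. *)
Definition towards (D : chords) (a b : nat) : bool :=
  `[< exists s, [/\ path (adj D) a (b :: s), uniq (a :: b :: s)
                  & last b s = 0%N] >].

(* Side i joins the vertices i and i.+1, where n.+1 is read as 0 in degree n; the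
   chord c = (a, b) has the sides
   a, .., b - 1 on one side of it and the remaining ones on the other. *)
Definition cuts_off (c : chord) (i : nat) : bool := (c.1 <= i < c.2)%N.

(* Sides i and j border the same face of the polygon cut along C: no chord of C
   separates them. *)
Definition same_face (C : chords) (i j : nat) : bool :=
  all (fun c => cuts_off c i == cuts_off c j) C.

(* S_C(alpha), for alpha the face bordered by side i, in increasing order *)
Definition face_sides (n : nat) (C : chords) (i : nat) : seq nat :=
  [seq j <- iota 0 n.+1 | same_face C i j].

(* Each face is indexed by its minimal side. *)
Definition min_sides (n : nat) (C : chords) : seq nat :=
  [seq i <- iota 0 n.+1 | head i (face_sides n C i) == i].

(* Contraction of the polygon onto the increasing nonempty list of sides T, all
   other sides (or the chords replacing them) being shrunk to points. The k-th
   side of T becomes side k, so vertex v becomes the vertex whose number is the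
   number of sides of T preceding v, read modulo size T. *)
Definition contract_vertex (T : seq nat) (v : nat) : nat :=
  count (fun t => t < v)%N T %% size T.

Definition contract_chord (T : seq nat) (c : chord) : chord :=
  let a := contract_vertex T c.1 in let b := contract_vertex T c.2 in
  (minn a b, maxn a b).

Definition contract (T : seq nat) (C : chords) : chords :=
  [fset contract_chord T c | c in C].

(* For c not crossing any chord of C and not in C: c lies in the face bordered by
   side i, i.e. it is on the same side as i of each chord of C. *)
Definition in_face (C : chords) (i : nat) (c : chord) : bool :=
  all (fun d => cuts_off d i == ((d.1 <= c.1) && (c.2 <= d.2)))%N C.

Definition q_face (C D : chords) (i : nat) : chords :=
  contract (face_sides #|` D| C i) [fset c in D | (c \notin C) && in_face C i c].

Definition r_diag (C D : chords) : chords := contract (min_sides #|` D| C) C.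

Definition k_diag (C D : chords) : nat :=
  let T := min_sides #|` D| C in
  #|` [fset c in C | towards D c.1 c.2 !=
        towards (r_diag C D) (contract_vertex T c.1) (contract_vertex T c.2)]|.

Definition HD (K : fieldType) : comAlgType K := {malg K[{cmonom diagram}]}.

Section DissectionAlgebra.
Variable K : fieldType.

(* The class of D in HD; the diagram of degree 0 is 1. The value 0 is for sets of
   chords which are not dissection diagrams. *)
Definition dclass (D : chords) : HD K :=
  if D == fset0 then 1 else
  if insub D is Some d then pvar K (d : diagram) else 0.

Definition q_prod (C D : chords) : HD K :=
  \prod_(i <- min_sides #|` D| C) dclass (q_face C D i).

Definition coproduct_gen (x : K) (D : chords) : tensor (HD K) (HD K) :=
  \sum_(C <- fpowerset D)
    x ^+ k_diag C D *: tens (q_prod C D) (dclass (r_diag C D)).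

Definition coproductD (x : K) : HD K -> tensor (HD K) (HD K) :=
  peval (B := tensor (HD K) (HD K)) (fun a => a *: (1 : tensor (HD K) (HD K)))
    (fun D : diagram => coproduct_gen x (val D)).

(* The algebra is graded and connected, with the constants in degree 0. *)
Definition counitD (f : HD K) : K := f@_mone.

Definition path_chords (n : nat) : chords :=
  if n is m.+1 then (0, n)%N |` [fset (i, i.+1) | i in iota 1 m] else fset0.

Definition pathY (n : nat) : HD K := dclass (path_chords n).

Definition EY_pred : {pred HD K} := fun f =>
  `[< exists s : seq (K * seq nat),
        f = \sum_(p <- s) p.1 *: \prod_(n <- p.2) pathY n >].

Lemma EY_subalg : GRing.subsemialg_closed EY_pred.
Proof.
have h0 : 0 \in EY_pred by apply/asboolP; exists [::]; rewrite big_nil.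
have hD f g : f \in EY_pred -> g \in EY_pred -> f + g \in EY_pred.
  move=> /asboolP[s ->] /asboolP[t ->]; apply/asboolP; exists (s ++ t).
  by rewrite big_cat.
split.
- by apply/asboolP; exists [:: (1, [::])]; rewrite big_seq1 big_nil scale1r.
- by split.
- move=> a f /asboolP[s ->]; apply/asboolP.
  exists [seq (a * p.1, p.2) | p <- s]; rewrite big_map scaler_sumr.
  by apply: eq_bigr => p _; rewrite scalerA.
- move=> f g /asboolP[s ->] /asboolP[t ->]; apply/asboolP.
  exists [seq (p.1 * q.1, p.2 ++ q.2) | p <- s, q <- t].
  rewrite big_allpairs_dep mulr_suml; apply: eq_bigr => p _.
  rewrite mulr_sumr; apply: eq_bigr => q _.
  by rewrite big_cat -scalerAl -scalerAr scalerA.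
Qed.

HB.instance Definition _ := GRing.isSubalgClosed.Build K (HD K) EY_pred EY_subalg.

Definition EY_type := {f : HD K | f \in EY_pred}.
HB.instance Definition _ := SubChoice.on EY_type.
HB.instance Definition _ := [SubChoice_isSubAlgebra of EY_type by <:].
HB.instance Definition _ := [SubNzRing_isSubComNzRing of EY_type by <:].
Definition EY : comAlgType K := EY_type.

End DissectionAlgebra.

Definition EY_incl (K : fieldType) (a : EY K) : HD K := \val (a : EY_type K).

(* HE is the Hopf algebra structure induced on EY by the operations of HD. The
   product and unit of EY are those of HD by construction. An antipode being the
   convolution inverse of the identity, there is at most one S as below. *)
Definition hopf_subalgebra (K : fieldType) (x : K) (HE : hopfAlgebra (EY K)) :
    Prop :=
  [/\ forall a, tmap (@EY_incl K) (@EY_incl K) (comul HE a) =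
                coproductD x (EY_incl a),
      forall a, counit HE a = counitD (EY_incl a)
    & forall S, is_antipode (coproductD x) (@counitD K) S ->
        forall a, EY_incl (antipode HE a) = S (EY_incl a)].

(* The series 1 + sum_(n >= 1) P n h^n. *)
Record G0 (K : fieldType) := MkG0 { coefG :> nat -> K; coefG0 : coefG 0%N = 1 }.

Lemma mulG0_subproof (K : fieldType) (P Q : G0 K) :
  \sum_(i < 1) P i * Q (0 - i)%N = 1.
Proof. by rewrite big_ord1 !coefG0 mulr1. Qed.

Definition mulG0 (K : fieldType) (P Q : G0 K) : G0 K :=
  @MkG0 K (fun n => \sum_(i < n.+1) P i * Q (n - i)%N) (mulG0_subproof P Q).

(* The polynomial variable number i stands for Sigma_(i+1). *)
Definition Sym (K : fieldType) : comAlgType K := {malg K[{cmonom nat}]}.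

(* the value at P of f, as a function on G0 *)
Definition evalG (K : fieldType) (f : Sym K) (P : G0 K) : K :=
  peval id (fun i => P i.+1) f.

(* For infinite K this determines the coproduct of HS, hence also its counit and
   antipode. *)
Definition sym_structure (K : fieldType) (HS : hopfAlgebra (Sym K)) : Prop :=
  forall (f : Sym K) (P Q : G0 K),
    tlift (fun g h => evalG g P * evalG h Q : K^o) (comul HS f) =
    evalG f (mulG0 P Q).

(* Main.v *)
From HB Require Import structures.
Require Import Defs.
From mathcomp Require Import all_boot all_algebra.
From mathcomp Require Import finmap.
From mathcomp.multinomials Require Import monalg.
From mathcomp.classical Require Import boolp.
From mathcomp Require Import zify.

(** Sym is the polynomial algebra on Sigma_1, Sigma_2, ..., and multiplying
    power series means Delta(Sigma_n) = sum_j Sigma_j (x) Sigma_(n-j).  For the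
    path trees, Delta(Y_n) = sum_k C(n,k) Y_(n-k) (x) Y_k: as
    C(n,k) = n!/(k!(n-k)!), the elements Y_n/n! satisfy the relations of the
    Sigma_n, so that Sigma_n |-> Y_n/n! is a morphism of Hopf algebras from Sym
    to HD.  Its image is EY, and it is injective because the Y_n with n >= 1 are
    pairwise distinct variables of the polynomial algebra HD: an explicit left
    inverse sends the variable Y_n to n! Sigma_n and all other diagrams to 0.

    The formula for Delta(Y_n) (coproduct_path) is a computation on chords.  The
    i-th chord of Y_n (1 <= i <= n) joins the endpoints of side i, hence it cuts
    off side i alone, and a subset C of the chords amounts to a set I of sides
    in 1, .., n.  The faces are the singletons {i}, i in I, which carry no chord,
    and the complement of I, which contains side 0.  Both q_C and r_C thus
    contract the polygon of a path tree onto a set of sides that contains 0 and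
    keep the chords of the other sides of this set; the outcome is again a path
    tree (contract_path), of degree n - |C| and |C| respectively.  No chord
    changes its orientation, so that every power of x in the sum is x^0, and
    grouping the subsets by cardinality produces the binomial coefficients.

    Identities between multiplicative maps on a polynomial algebra are checked on
    the variables (amorph_poly_ext); this gives the Hopf axioms for Sym
    (hopf_Sym) and the compatibility with the coproduct of HD (comul_of_sym).
    The Hopf structure of EY is that of Sym transported along the isomorphism
    (hopf_transport).  It is the one induced by HD: for the antipode this is the
    uniqueness of convolution inverses (convol_inverse_unique), applied to the
    linear maps from EY to HD, where the inclusion has the restricted antipode
    of HD as left inverse and the antipode of EY as right inverse. *)

Set Implicit Arguments.
Unset Strict Implicit.
Unset Printing Implicit Defensive.

Import GRing.Theory.

Local Open Scope fset_scope.
Local Open Scope ring_scope.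

(** * Linear maps out of tensor products *)

(** Linearity is kept as a plain hypothesis, as in the statement of the Hopf
    axioms: most of the maps below are composites of tlift and tmap, for which
    bundled linear maps would have to be rebuilt at every step. *)
Section LinearMaps.
Variables (K : fieldType) (U V : lmodType K).
Implicit Types (F : U -> V).

Lemma lin0 F : linear F -> F 0 = 0.
Proof.
by move=> h; have := h (-1) 0 0; rewrite scaler0 addr0 scaleN1r addNr.
Qed.

Lemma linD F : linear F -> {morph F : x y / x + y}.
Proof. by move=> h x y; have := h 1 x y; rewrite !scale1r. Qed.

Lemma linZ F : linear F -> forall a x, F (a *: x) = a *: F x.
Proof. by move=> h a x; have := h a x 0; rewrite lin0 // !addr0. Qed.

Lemma lin_sum F : linear F -> forall I (r : seq I) (P : pred I) (G : I -> U),
  F (\sum_(i <- r | P i) G i) = \sum_(i <- r | P i) F (G i).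
Proof.
by move=> h I r P G; rewrite (big_morph F (linD h) (lin0 h)).
Qed.
End LinearMaps.

Lemma bilin_suml (K : fieldType) (U V W : lmodType K) (B : U -> V -> W) :
  bilin B -> forall I (r : seq I) (P : pred I) (G : I -> U) v,
  B (\sum_(i <- r | P i) G i) v = \sum_(i <- r | P i) B (G i) v.
Proof. by move=> h I r P G v; apply: (lin_sum (h.1 v)). Qed.

Lemma bilin_sumr (K : fieldType) (U V W : lmodType K) (B : U -> V -> W) :
  bilin B -> forall I (r : seq I) (P : pred I) (G : I -> V) u,
  B u (\sum_(i <- r | P i) G i) = \sum_(i <- r | P i) B u (G i).
Proof. by move=> h I r P G u; apply: (lin_sum (h.2 u)). Qed.

Lemma lin_comp (K : fieldType) (U V W : lmodType K) (F : V -> W) (G : U -> V) :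
  linear F -> linear G -> linear (fun x => F (G x)).
Proof. by move=> hF hG a x y; rewrite hG hF. Qed.

Lemma lin_id (K : fieldType) (U : lmodType K) : linear (fun x : U => x).
Proof. by []. Qed.

Lemma bilin_comp (K : fieldType) (U V U' V' W W' : lmodType K)
    (H : W -> W') (B : U' -> V' -> W) (f : U -> U') (g : V -> V') :
  linear H -> bilin B -> linear f -> linear g ->
  bilin (fun u v => H (B (f u) (g v))).
Proof.
move=> hH hB hf hg; split=> [v a u u' | u a v v'] /=.
  by rewrite hf (hB.1 (g v)) hH.
by rewrite hg (hB.2 (f u)) hH.
Qed.

Section TensorMaps.
Variables (K : fieldType) (U V : lmodType K).
Implicit Types (W : lmodType K).

(** The quotient representative is an honest list of pure tensors; this is what
    allows linear maps to be compared on pure tensors only. *)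
Lemma tens_sum (x : tensor U V) : x = \sum_(p <- repr x) tens p.1 p.2.
Proof.
apply: tensorP => W B hB.
rewrite (lin_sum (tlift_linear hB)).
by apply: eq_bigr => p _; rewrite tlift_tens.
Qed.

Lemma tensor_linear_ext W (F G : tensor U V -> W) :
  linear F -> linear G -> (forall u v, F (tens u v) = G (tens u v)) -> F =1 G.
Proof.
move=> hF hG e x; rewrite (tens_sum x) !lin_sum //.
by apply: eq_bigr => p _; rewrite e.
Qed.

Lemma lin_tlift_comp W W' (F : W -> W') (B : U -> V -> W) x :
  linear F -> F (tlift B x) = tlift (fun u v => F (B u v)) x.
Proof. by move=> hF; rewrite /tlift /tsum lin_sum. Qed.

Lemma tliftD_fun W (B B' : U -> V -> W) (a : K) x :
  tlift (fun u v => a *: B u v + B' u v) x = a *: tlift B x + tlift B' x.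
Proof. by rewrite /tlift /tsum scaler_sumr -big_split. Qed.
End TensorMaps.

Section Tmap.
Variable K : fieldType.
Implicit Types U V : lmodType K.

Lemma tmap_bilin U V U' V' (f : U -> U') (g : V -> V') :
  linear f -> linear g -> bilin (fun u v => tens (f u) (g v)).
Proof. exact: (bilin_comp (@lin_id _ _) (@tens_bilin K U' V')). Qed.

Lemma tmap_linear U V U' V' (f : U -> U') (g : V -> V') :
  linear f -> linear g -> linear (tmap f g).
Proof. by move=> hf hg; apply/tlift_linear/tmap_bilin. Qed.

Lemma tmap_tens U V U' V' (f : U -> U') (g : V -> V') u v :
  linear f -> linear g -> tmap f g (tens u v) = tens (f u) (g v).
Proof. by move=> hf hg; rewrite /tmap tlift_tens //; apply: tmap_bilin. Qed.

Lemma tmap_comp U V U' V' U'' V'' (f' : U' -> U'') (g' : V' -> V'')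
    (f : U -> U') (g : V -> V') x :
  linear f -> linear g -> linear f' -> linear g' ->
  tmap f' g' (tmap f g x) = tmap (fun u => f' (f u)) (fun v => g' (g v)) x.
Proof.
move=> hf hg hf' hg'; have hff := lin_comp hf' hf; have hgg := lin_comp hg' hg.
move: x; apply: tensor_linear_ext; last by move=> u v; rewrite !tmap_tens.
  by apply: lin_comp; apply: tmap_linear.
exact: tmap_linear.
Qed.

Lemma tmap_id U V (f : U -> U) (g : V -> V) x :
  f =1 id -> g =1 id -> tmap f g x = x.
Proof.
move=> /funext -> /funext ->; move: x; apply: tensor_linear_ext => //.
  exact: tmap_linear.
by move=> u v; rewrite tmap_tens.
Qed.

Lemma tlift_tmap U V U' V' (W : lmodType K) (B : U' -> V' -> W)
    (f : U -> U') (g : V -> V') x :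
  bilin B -> linear f -> linear g ->
  tlift B (tmap f g x) = tlift (fun u v => B (f u) (g v)) x.
Proof.
move=> hB hf hg.
rewrite {1}/tmap (lin_tlift_comp _ _ (tlift_linear hB)).
by apply: eq_tlift => u v; rewrite tlift_tens.
Qed.

Lemma tassoc_bilin_in U V (W : lmodType K) (w : W) :
  bilin (fun (u : U) (v : V) => tens u (tens v w)).
Proof.
split=> [v a u u' | u a v v'] /=; first exact: (tens_bilin _ _).1.
by rewrite (tens_bilin _ _).1 (tens_bilin _ _).2.
Qed.

Lemma tassoc_bilin U V (W : lmodType K) :
  bilin (fun (t : tensor U V) (w : W) => tlift (fun u v => tens u (tens v w)) t).
Proof.
split=> [w | t a w w'] /=; first exact/tlift_linear/tassoc_bilin_in.
rewrite -tliftD_fun; apply: eq_tlift => u v.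
by rewrite (tens_bilin _ _).2 (tens_bilin _ _).2.
Qed.

Lemma tassoc_linear U V (W : lmodType K) : linear (@tassoc K U V W).
Proof. exact/tlift_linear/tassoc_bilin. Qed.

Lemma tassoc_tens U V (W : lmodType K) (u : U) (v : V) (w : W) :
  tassoc (tens (tens u v) w) = tens u (tens v w).
Proof.
rewrite /tassoc tlift_tens; last exact: tassoc_bilin.
by rewrite tlift_tens //; apply: tassoc_bilin_in.
Qed.

(** Naturality of the associator: this is what carries coassociativity along an
    isomorphism of algebras. *)
Lemma tassoc_tmap U V (W : lmodType K) U' V' (W' : lmodType K)
    (f : U -> U') (g : V -> V') (h : W -> W') x :
  linear f -> linear g -> linear h ->
  tassoc (tmap (tmap f g) h x) = tmap f (tmap g h) (tassoc x).
Proof.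
move=> hf hg hh; have hfg := tmap_linear hf hg; have hgh := tmap_linear hg hh.
have hL := tmap_linear hfg hh; have hR := tmap_linear hf hgh.
move: x; apply: tensor_linear_ext.
- exact: (lin_comp (@tassoc_linear _ _ _) hL).
- exact: (lin_comp hR (@tassoc_linear _ _ _)).
move=> t w; rewrite tmap_tens //; move: t; apply: tensor_linear_ext.
- move=> a t t'; rewrite hfg (tens_bilin _ _).1; exact: tassoc_linear.
- by move=> a t t'; rewrite (tens_bilin _ _).1 (@tassoc_linear _ _ _) hR.
by move=> u v; rewrite tassoc_tens !tmap_tens // tassoc_tens.
Qed.
End Tmap.

(** * Bilinear products and multiplicative maps *)

(** tensor A B is a ring only when A and B are algebras with 1 != 0, a property
    that is not asserted of tensor A B itself.  Triple tensor products are needed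
    for coassociativity, so products on modules are taken as data. *)
Record prodOn (K : fieldType) (U : lmodType K) := ProdOn {
  pmul : U -> U -> U;
  pone : U;
  pmul_bilin : bilin pmul
}.

Definition amorph (K : fieldType) (U V : lmodType K) (P : prodOn U) (Q : prodOn V)
    (F : U -> V) : Prop :=
  [/\ linear F, F (pone P) = pone Q
    & forall x y, F (pmul P x y) = pmul Q (F x) (F y)].

Section Products.
Variable K : fieldType.

Lemma alg_mul_bilin (A : comAlgType K) : bilin (fun x y : A => x * y).
Proof.
split=> [v a x y | u a x y] /=; first by rewrite mulrDl -scalerAl.
by rewrite mulrDr -scalerAr.
Qed.

Definition prod_alg (A : comAlgType K) : prodOn A :=
  ProdOn 1 (alg_mul_bilin A).

Lemma tens_ring_bilin (A B : comAlgType K) : bilin (fun x y : tensor A B => x * y).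
Proof.
split=> [v a x y | u a x y] /=; first by rewrite mulrDl -tens_scaleAl.
by rewrite mulrDr mulrC -tens_scaleAl mulrC.
Qed.

Section TensorProduct.
Variables (U V : lmodType K) (P : prodOn U) (Q : prodOn V).

Definition tens_pmul (x y : tensor U V) : tensor U V :=
  tlift (fun a b => tlift (fun c d => tens (pmul P a c) (pmul Q b d)) y) x.

Lemma tens_pmul_in a b : bilin (fun c d => tens (pmul P a c) (pmul Q b d)).
Proof.
exact: (bilin_comp (@lin_id _ _) (@tens_bilin K U V)
         ((pmul_bilin P).2 a) ((pmul_bilin Q).2 b)).
Qed.

Lemma tens_pmul_out y :
  bilin (fun a b => tlift (fun c d => tens (pmul P a c) (pmul Q b d)) y).
Proof.
split=> [b k a a' | a k b b'] /=; rewrite -tliftD_fun; apply: eq_tlift => c d.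
  by rewrite ((pmul_bilin P).1 c) (tens_bilin _ _).1.
by rewrite ((pmul_bilin Q).1 d) (tens_bilin _ _).2.
Qed.

Lemma tens_pmulE a b c d :
  tens_pmul (tens a b) (tens c d) = tens (pmul P a c) (pmul Q b d).
Proof.
rewrite /tens_pmul tlift_tens; last exact: tens_pmul_out.
by rewrite tlift_tens //; apply: tens_pmul_in.
Qed.

Lemma tens_pmul_bilin : bilin tens_pmul.
Proof.
split=> [y | x]; first exact/tlift_linear/tens_pmul_out.
move=> k y y'; rewrite /tens_pmul -tliftD_fun; apply: eq_tlift => a b.
by apply: tlift_linear; apply: tens_pmul_in.
Qed.

Definition prod_tens : prodOn (tensor U V) :=
  ProdOn (tens (pone P) (pone Q)) tens_pmul_bilin.

(** Multiplicativity of tlift B is bilinear in the two arguments, so pure tensors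
    suffice. *)
Lemma amorph_tlift (W : lmodType K) (R : prodOn W) (B : U -> V -> W) :
  bilin B -> B (pone P) (pone Q) = pone R ->
  (forall a b c d, B (pmul P a c) (pmul Q b d) = pmul R (B a b) (B c d)) ->
  amorph prod_tens R (tlift B).
Proof.
move=> hB h1 hM; have hL := tlift_linear hB.
split=> //; first by rewrite /= tlift_tens.
move=> x y; move: x; apply: tensor_linear_ext.
- exact: (lin_comp hL (tens_pmul_bilin.1 y)).
- exact: (lin_comp ((pmul_bilin R).1 (tlift B y)) hL).
move=> a b; move: y; apply: tensor_linear_ext.
- exact: (lin_comp hL (tens_pmul_bilin.2 _)).
- exact: (lin_comp ((pmul_bilin R).2 _) hL).
by move=> c d; rewrite /= tens_pmulE !tlift_tens.
Qed.
End TensorProduct.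

Lemma prod_tens_alg (A B : comAlgType K) (x y : tensor A B) :
  pmul (prod_tens (prod_alg A) (prod_alg B)) x y = x * y.
Proof.
move: x; apply: tensor_linear_ext.
- exact: (tens_pmul_bilin (prod_alg A) (prod_alg B)).1.
- exact: (@tens_ring_bilin A B).1.
move=> a b; move: y; apply: tensor_linear_ext.
- exact: (tens_pmul_bilin (prod_alg A) (prod_alg B)).2.
- exact: (@tens_ring_bilin A B).2.
by move=> c d; rewrite /= tens_pmulE tensM.
Qed.

Lemma amorph_comp (U V W : lmodType K) (P : prodOn U) (Q : prodOn V) (R : prodOn W)
    (F : V -> W) (G : U -> V) :
  amorph Q R F -> amorph P Q G -> amorph P R (fun x => F (G x)).
Proof.
move=> [hF F1 FM] [hG G1 GM]; split; first exact: lin_comp.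
  by rewrite G1.
by move=> x y; rewrite GM.
Qed.

Lemma amorph_id (U : lmodType K) (P : prodOn U) : amorph P P (fun x => x).
Proof. by []. Qed.

Lemma amorph_tmap (U V U' V' : lmodType K) (P : prodOn U) (Q : prodOn V)
    (P' : prodOn U') (Q' : prodOn V') (f : U -> U') (g : V -> V') :
  amorph P P' f -> amorph Q Q' g ->
  amorph (prod_tens P Q) (prod_tens P' Q') (tmap f g).
Proof.
move=> [hf f1 fM] [hg g1 gM]; apply: amorph_tlift.
- exact: tmap_bilin.
- by rewrite f1 g1.
by move=> a b c d; rewrite fM gM [RHS]tens_pmulE.
Qed.

Lemma amorph_tassoc (U V W : lmodType K) (P : prodOn U) (Q : prodOn V)
    (R : prodOn W) :
  amorph (prod_tens (prod_tens P Q) R) (prod_tens P (prod_tens Q R))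
    (@tassoc K U V W).
Proof.
have hL := @tassoc_linear K U V W.
have hM1 := (pmul_bilin (prod_tens (prod_tens P Q) R)).
have hM2 := (pmul_bilin (prod_tens P (prod_tens Q R))).
have hT (w : W) : linear (fun t : tensor U V => tens t w).
  exact: (tens_bilin _ _).1.
split=> //; first by rewrite /= tassoc_tens.
move=> x y; move: x; apply: tensor_linear_ext.
- exact: (lin_comp hL (hM1.1 y)).
- exact: (lin_comp (hM2.1 _) hL).
move=> t w; move: y; apply: tensor_linear_ext.
- exact: (lin_comp hL (hM1.2 _)).
- exact: (lin_comp (hM2.2 _) hL).
move=> t' w'; rewrite [pmul _ _ _]tens_pmulE.
move: t; apply: tensor_linear_ext.
- exact: (lin_comp hL (lin_comp (hT (pmul R w w')) ((tens_pmul_bilin P Q).1 t'))).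
- exact: (lin_comp (hM2.1 _) (lin_comp hL (hT _))).
move=> u v; move: t'; apply: tensor_linear_ext.
- exact: (lin_comp hL (lin_comp (hT (pmul R w w')) ((tens_pmul_bilin P Q).2 _))).
- exact: (lin_comp (hM2.2 _) (lin_comp hL (hT _))).
move=> u' v'.
by rewrite !tassoc_tens /= !tens_pmulE tassoc_tens /= tens_pmulE.
Qed.
End Products.

(** * Maps out of polynomial algebras *)

Section PolynomialAlgebra.
Variables (K : fieldType) (I : choiceType).
Local Notation Poly := {malg K[{cmonom I}]}.
Implicit Types (f g : Poly) (m : {cmonom I}).

Lemma malgUM m1 m2 : << mmul m1 m2 >> = << m1 >> * << m2 >> :> Poly.
Proof. by rewrite malgM_def fgmulUU mulr1. Qed.

Lemma malgUZ (a : K) m : << a *g m >> = a *: << m >> :> Poly.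
Proof.
by apply/malgP => k; rewrite mcoeffU [RHS]mcoeffZ mcoeffU mulrnAr mulr1.
Qed.

(* monomial = product of variables *)
(** A monomial other than 1 is divisible by one of its variables, with a quotient
    of smaller degree. *)
Lemma cmonom_ind (P : {cmonom I} -> Prop) :
  P mone -> (forall i m, P m -> P (mmul (ucm i) m)) -> forall m, P m.
Proof.
move=> P1 PM m; have [n] := ubnP (mdeg m); elim: n m => // n IH m lt_m.
have [m0|[i im]] := fset_0Vmem (finsupp m).
  suff -> : m = mone by [].
  by apply/eqP; rewrite -mdeg_eq0 mdegE m0 big_seq_fset0.
have em : m = mmul (ucm i) (divcm m (ucm i)).
  apply/eqP/cmP => j; rewrite cmM divcmE ucmE.
  case: eqVneq => [<-|_] /=; last by rewrite subn0.
  by rewrite subnKC // lt0n cmE_neq0.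
rewrite em; apply: PM; apply: IH.
by move: lt_m; rewrite {1}em mdegM mdegU add1n ltnS.
Qed.

(** The variables generate the polynomial algebra.  The target carries just a
    bilinear product, so that triple tensor products qualify. *)
Lemma amorph_poly_ext (W : lmodType K) (Q : prodOn W) (F G : Poly -> W) :
  amorph (prod_alg Poly) Q F -> amorph (prod_alg Poly) Q G ->
  (forall i, F (pvar K i) = G (pvar K i)) -> F =1 G.
Proof.
move=> [hF F1 FM] [hG G1 GM] e f.
rewrite (monalgE f) !lin_sum //; apply: eq_bigr => m _.
rewrite malgUZ !linZ //; congr (_ *: _).
elim/cmonom_ind: m => [|i m IH]; first by rewrite [LHS]F1 [RHS]G1.
by rewrite malgUM [LHS]FM [RHS]GM; congr (pmul Q _ _); [exact: e|].
Qed.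

Section Peval.
Variables (R : comPzRingType) (c : {rmorphism K -> R}) (h : I -> R).

Definition monom_eval m : R := \prod_(i <- finsupp m) h i ^+ m i.

Lemma monom_eval_sub m (d : {fset I}) : finsupp m `<=` d ->
  monom_eval m = \prod_(i <- d) h i ^+ m i.
Proof.
move=> s; apply: big_fset_incl => // i _; rewrite -cmE_eq0 => /eqP ->.
by rewrite expr0.
Qed.

Lemma monom_eval1 : monom_eval mone = 1.
Proof. by rewrite /monom_eval mdom1 big_seq_fset0. Qed.

Lemma monom_evalM m1 m2 :
  monom_eval (mmul m1 m2) = monom_eval m1 * monom_eval m2.
Proof.
rewrite (monom_eval_sub (m := m1) (d := finsupp (mmul m1 m2))); last first.
  by rewrite mdomD fsubsetUl.
rewrite (monom_eval_sub (m := m2) (d := finsupp (mmul m1 m2))); last first.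
  by rewrite mdomD fsubsetUr.
by rewrite -big_split; apply: eq_bigr => i _; rewrite /= cmM exprD.
Qed.

(** The support of a sum or of a multiple is only included in the expected set,
    hence the freedom in the range of summation. *)
Lemma peval_sub f (d : {fset {cmonom I}}) : msupp f `<=` d ->
  peval c h f = \sum_(m <- d) c f@_m * monom_eval m.
Proof.
move=> s; apply: big_fset_incl => // m _ /mcoeff_outdom ->.
by rewrite rmorph0 mul0r.
Qed.

Lemma pevalD : {morph peval c h : f g / f + g}.
Proof.
move=> f g; pose d := msupp f `|` msupp g.
rewrite (@peval_sub _ d (msuppD_le f g)) (@peval_sub f d (fsubsetUl _ _)).
rewrite (@peval_sub g d (fsubsetUr _ _)) -big_split; apply: eq_bigr => m _ /=.
by rewrite mcoeffD rmorphD mulrDl.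
Qed.

Lemma pevalZ a f : peval c h (a *: f) = c a * peval c h f.
Proof.
rewrite (@peval_sub _ _ (msuppZ_le a f)) /peval mulr_sumr; apply: eq_bigr => m _.
by rewrite mcoeffZ rmorphM mulrA.
Qed.

Lemma pevalZU a m : peval c h << a *g m >> = c a * monom_eval m.
Proof.
by rewrite (@peval_sub _ _ (msuppU_le (x := a))) big_seq_fset1 mcoeffUU.
Qed.

Lemma pevalU m : peval c h << m >> = monom_eval m.
Proof. by rewrite pevalZU rmorph1 mul1r. Qed.

Lemma peval1 : peval c h 1 = 1.
Proof. by rewrite [LHS]pevalU monom_eval1. Qed.

Lemma peval_sum J (r : seq J) (P : pred J) (F : J -> Poly) :
  peval c h (\sum_(j <- r | P j) F j) = \sum_(j <- r | P j) peval c h (F j).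
Proof.
apply: (big_morph _ pevalD); rewrite -(scale0r (0 : Poly)) pevalZ.
by rewrite rmorph0 mul0r.
Qed.

Lemma pevalM : {morph peval c h : f g / f * g}.
Proof.
move=> f g; rewrite malgME; apply: etrans (peval_sum _ _ _) _.
rewrite [in RHS]/peval [RHS]mulr_suml; apply: eq_bigr => m _.
apply: etrans (peval_sum _ _ _) _.
rewrite [RHS]mulr_sumr; apply: eq_bigr => n _.
by rewrite [LHS]pevalZU rmorphM monom_evalM mulrACA.
Qed.
End Peval.

Lemma peval_var (R : comPzRingType) (c : K -> R) (h : I -> R) i :
  c 1 = 1 -> peval c h (pvar K i) = h i.
Proof.
move=> c1; rewrite /peval msuppU1 big_seq_fset1 mcoeffUU c1 mul1r.
by rewrite mdomU big_seq_fset1 cmUU expr1.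
Qed.

Lemma amorph_peval (B : comAlgType K) (c : {rmorphism K -> B}) (h : I -> B) :
  (forall a y, c a * y = a *: y) ->
  amorph (prod_alg Poly) (prod_alg B) (peval c h).
Proof.
move=> cE; split; [|exact: (peval1 c)|exact: (pevalM c)].
by move=> a f g; rewrite (pevalD c) (pevalZ c) cE.
Qed.

Lemma amorph_peval_alg (B : comAlgType K) (h : I -> B) :
  amorph (prod_alg Poly) (prod_alg B) (peval (fun a => a%:A) h).
Proof. by apply: (amorph_peval (c := in_alg B)) => a y; rewrite mulr_algl. Qed.

Lemma amorph_peval_id (h : I -> K) :
  amorph (prod_alg Poly) (prod_alg K^o) (peval (fun a => a) h).
Proof. exact: (amorph_peval (B := K^o) (c := idfun)). Qed.

Lemma amorph_peval_tens (A B : comAlgType K) (h : I -> tensor A B) :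
  amorph (prod_alg Poly) (prod_tens (prod_alg A) (prod_alg B))
    (peval (fun a => a *: (1 : tensor A B)) h).
Proof.
have cD : zmod_morphism (fun a : K => a *: (1 : tensor A B)).
  by move=> a b; rewrite scalerBl.
have cM : monoid_morphism (fun a : K => a *: (1 : tensor A B)).
  split; first by rewrite scale1r.
  by move=> a b; rewrite -tens_scaleAl mul1r scalerA.
pose c : {rmorphism K -> tensor A B} := HB.pack (fun a : K => a *: (1 : tensor A B))
  (GRing.isZmodMorphism.Build _ _ _ cD) (GRing.isMonoidMorphism.Build _ _ _ cM).
split; first 1 last.
- exact: (peval1 c).
- by move=> f g; rewrite prod_tens_alg; apply: (pevalM c).
by move=> a f g; rewrite (pevalD c) (pevalZ c) /= -tens_scaleAl mul1r.
Qed.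
End PolynomialAlgebra.

(** * Convolution inverses and transport of Hopf structures *)

Section HopfTheory.
Variable K : fieldType.

Lemma convol_bilin (A A' B : comAlgType K) (F : A -> B) (G : A' -> B) :
  linear F -> linear G -> bilin (fun u v => F u * G v).
Proof.
exact: (bilin_comp (@lin_id K B) (@alg_mul_bilin K B)).
Qed.

(** The usual F = F * (I * T) = (F * I) * T = T for the convolution product: the
    bilinear maps right and left are the two bracketings of F(u) I(v) T(w), they
    agree up to the associator, and coassociativity identifies their values. *)
Lemma convol_inverse_unique (A B : comAlgType K) (H : hopfAlgebra A)
    (F I T : A -> B) :
  linear F -> linear I -> linear T ->
  (forall a, tlift (fun u v => F u * I v) (comul H a) = (counit H a)%:A) ->
  (forall a, tlift (fun u v => I u * T v) (comul H a) = (counit H a)%:A) ->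
  F =1 T.
Proof.
move=> hF hI hT hFI hIT a; have hD := comul_linear H.
have hbFI := convol_bilin hF hI; have hbIT := convol_bilin hI hT.
pose right u t : B := F u * tlift (fun v w => I v * T w) t.
pose left t w : B := tlift (fun u v => F u * I v) t * T w.
have hright : bilin right.
  exact: (bilin_comp (@lin_id K B) (@alg_mul_bilin K B) hF (tlift_linear hbIT)).
have hleft : bilin left.
  exact: (bilin_comp (@lin_id K B) (@alg_mul_bilin K B) (tlift_linear hbFI) hT).
have assoc : forall y, tlift right (tassoc y) = tlift left y.
  have hL := tlift_linear hleft.
  have hR := lin_comp (tlift_linear hright) (@tassoc_linear K A A A).
  apply: tensor_linear_ext => // t w; rewrite tlift_tens //.
  move: t; apply: tensor_linear_ext.
  - exact: (lin_comp hR ((@tens_bilin K _ A).1 w)).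
  - exact: (hleft.1 w).
  by move=> u v; rewrite tassoc_tens tlift_tens // /right /left !tlift_tens // mulrA.
have Fa : tlift right (tmap id (comul H) (comul H a)) = F a.
  rewrite tlift_tmap // -[in RHS](counitr H a) (lin_tlift_comp _ _ hF).
  by apply: eq_tlift => u v; rewrite /right hIT (linZ hF) mulr_algr.
have Ta : tlift left (tmap (comul H) id (comul H a)) = T a.
  rewrite tlift_tmap // -[in RHS](counitl H a) (lin_tlift_comp _ _ hT).
  by apply: eq_tlift => u v; rewrite /left hFI (linZ hT) mulr_algl.
by rewrite -Fa -Ta -assoc coassoc.
Qed.

Section Transport.
Variables (A B : comAlgType K) (H : hopfAlgebra A).
Variables (phi : {lrmorphism A -> B}) (psi : {lrmorphism B -> A}).
Hypotheses (phiK : cancel phi psi) (psiK : cancel psi phi).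

Let hphi : linear phi. Proof. exact: linearP. Qed.
Let hpsi : linear psi. Proof. exact: linearP. Qed.
Let hD := comul_linear H.
Let heps := counit_scalar H.

Definition comul_tr b := tmap phi phi (comul H (psi b)).
Definition counit_tr b := counit H (psi b).
Definition antipode_tr b := phi (antipode H (psi b)).

Lemma comul_tr_linear : linear comul_tr.
Proof. exact: lin_comp (tmap_linear hphi hphi) (lin_comp hD hpsi). Qed.

Lemma amorph_lrmorphism (C D : comAlgType K) (f : {lrmorphism C -> D}) :
  amorph (prod_alg C) (prod_alg D) f.
Proof. by split; [exact: linearP | exact: rmorph1 | exact: rmorphM]. Qed.

Lemma comul_tr_monoid : monoid_morphism comul_tr.
Proof.
have [_ h1 hM] := amorph_tmap (amorph_lrmorphism phi) (amorph_lrmorphism phi).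
split; first by rewrite /comul_tr rmorph1 (comul_monoid H).1; exact: h1.
move=> x y; rewrite /comul_tr rmorphM (comul_monoid H).2.
by rewrite -!prod_tens_alg hM.
Qed.

Lemma counit_tr_scalar : scalar counit_tr.
Proof. by move=> a x y; rewrite /counit_tr hpsi heps. Qed.

Lemma counit_tr_monoid : monoid_morphism counit_tr.
Proof.
split; first by rewrite /counit_tr rmorph1 (counit_monoid H).1.
by move=> x y; rewrite /counit_tr rmorphM (counit_monoid H).2.
Qed.

Lemma coassoc_tr b :
  tassoc (tmap comul_tr id (comul_tr b)) = tmap id comul_tr (comul_tr b).
Proof.
have hpp := tmap_linear hphi hphi.
rewrite [comul_tr b]/comul_tr !tmap_comp //; try exact: comul_tr_linear.
have -> : (fun u => comul_tr (phi u)) = (fun u => tmap phi phi (comul H u)).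
  by apply: funext => u; rewrite /comul_tr phiK.
transitivity (tassoc (tmap (tmap phi phi) phi (tmap (comul H) id (comul H (psi b))))).
  by rewrite [in RHS]tmap_comp.
by rewrite tassoc_tmap // coassoc tmap_comp.
Qed.

Lemma counitl_tr b : tlift (fun u v => counit_tr u *: v) (comul_tr b) = b.
Proof.
rewrite /comul_tr tlift_tmap //.
  rewrite -[RHS]psiK -[in RHS](counitl H (psi b)) (lin_tlift_comp _ _ hphi).
  by apply: eq_tlift => u v; rewrite /counit_tr phiK (linZ hphi).
split=> [v a u u' | u a v v'] /=.
  by rewrite counit_tr_scalar scalerDl scalerA.
by rewrite scalerDr !scalerA mulrC.
Qed.

Lemma counitr_tr b : tlift (fun u v => counit_tr v *: u) (comul_tr b) = b.
Proof.
rewrite /comul_tr tlift_tmap //.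
  rewrite -[RHS]psiK -[in RHS](counitr H (psi b)) (lin_tlift_comp _ _ hphi).
  by apply: eq_tlift => u v; rewrite /counit_tr phiK (linZ hphi).
split=> [v a u u' | u a v v'] /=.
  by rewrite scalerDr !scalerA mulrC.
by rewrite counit_tr_scalar scalerDl scalerA.
Qed.

Lemma antipode_trP : is_antipode comul_tr counit_tr antipode_tr.
Proof.
have [hS Sl Sr] := antipodeP H.
have hSt : linear antipode_tr by exact: lin_comp hphi (lin_comp hS hpsi).
split=> // b; rewrite /comul_tr tlift_tmap //.
- transitivity (phi (counit H (psi b))%:A); last by rewrite linearZ rmorph1.
  rewrite -[in RHS]Sl (lin_tlift_comp _ _ hphi).
  by apply: eq_tlift => u v; rewrite /antipode_tr phiK rmorphM.
- exact: (convol_bilin hSt (@lin_id K B)).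
- transitivity (phi (counit H (psi b))%:A); last by rewrite linearZ rmorph1.
  rewrite -[in RHS]Sr (lin_tlift_comp _ _ hphi).
  by apply: eq_tlift => u v; rewrite /antipode_tr phiK rmorphM.
- exact: (convol_bilin (@lin_id K B) hSt).
Qed.

Definition hopf_transport : hopfAlgebra B :=
  HopfAlgebra comul_tr_linear comul_tr_monoid counit_tr_scalar counit_tr_monoid
    coassoc_tr counitl_tr counitr_tr antipode_trP.

Lemma hopf_transport_isom : hopf_isomorphic hopf_transport H.
Proof.
exists psi; first by exists phi.
split=> b //=; last by rewrite /antipode_tr phiK.
by rewrite /comul_tr tmap_comp // tmap_id.
Qed.
End Transport.
End HopfTheory.

(** * The Hopf algebra Sym *)

(** Both sides sum over 0 <= k <= j <= n; for coassociativity of Sym, where the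
    two bracketings produce one sum each. *)
Lemma triangle_sum (V : nmodType) (n : nat) (G : nat -> nat -> V) :
  \sum_(j < n.+1) \sum_(k < j.+1) G k j =
  \sum_(k < n.+1) \sum_(l < (n - k).+1) G k (k + l)%N.
Proof.
elim: n => [|n IH]; first by rewrite !big_ord1.
rewrite big_ord_recr IH [RHS]big_ord_recr /= subnn big_ord1 addn0.
rewrite [in LHS](big_ord_recr n.+1) /= addrA -big_split; congr (_ + _).
apply: eq_bigr => k _; rewrite subSn; last by rewrite -ltnS.
by rewrite [RHS]big_ord_recr /= addnS subnKC // -ltnS.
Qed.

Section SymHopf.
Variable K : fieldType.
Local Notation S := (Sym K).

Definition sigma n : S := if n is m.+1 then pvar K m else 1.

Lemma amorph_sym_ext (W : lmodType K) (Q : prodOn W) (F G : S -> W) :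
  amorph (prod_alg S) Q F -> amorph (prod_alg S) Q G ->
  (forall n, F (sigma n) = G (sigma n)) -> F =1 G.
Proof. by move=> hF hG e; apply: (amorph_poly_ext hF hG) => i; exact: (e i.+1). Qed.

Definition comulS : S -> tensor S S :=
  peval (fun a => a *: (1 : tensor S S))
    (fun i => \sum_(j < i.+2) tens (sigma j) (sigma (i.+1 - j))).

Lemma amorph_comulS :
  amorph (prod_alg S) (prod_tens (prod_alg S) (prod_alg S)) comulS.
Proof. exact: amorph_peval_tens. Qed.

Lemma comulS_sigma n :
  comulS (sigma n) = \sum_(j < n.+1) tens (sigma j) (sigma (n - j)).
Proof.
case: n => [|n]; last by rewrite /comulS peval_var // scale1r.
by have [_ -> _] := amorph_comulS; rewrite big_ord1.
Qed.

Lemma comulS_monoid : monoid_morphism comulS.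
Proof.
have [_ h1 hM] := amorph_comulS; split=> // f g.
by rewrite -prod_tens_alg; apply: hM.
Qed.

Definition counitS : S -> K := peval (fun a => a) (fun=> 0).

Lemma amorph_counitS : amorph (prod_alg S) (prod_alg K^o) counitS.
Proof. exact: amorph_peval_id. Qed.

Lemma counitS_sigma n : counitS (sigma n) = (n == 0)%:R.
Proof.
case: n => [|n]; last by rewrite /counitS peval_var.
by have [_ -> _] := amorph_counitS.
Qed.

(** The coefficients of the inverse of the generic series 1 + sum_n Sigma_n h^n;
    each one is determined by all the previous ones, so the recursion builds the
    list of the first n + 1 of them. *)
Fixpoint inv_sigmas (n : nat) : seq S :=
  if n is m.+1 then
    let s := inv_sigmas m in rcons s (- \sum_(j < m.+1) s`_j * sigma (m.+1 - j))
  else [:: 1].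

Definition inv_sigma n := (inv_sigmas n)`_n.

Lemma size_inv_sigmas n : size (inv_sigmas n) = n.+1.
Proof. by elim: n => //= n IH; rewrite size_rcons IH. Qed.

Lemma nth_inv_sigmas n j : (j <= n)%N -> (inv_sigmas n)`_j = inv_sigma j.
Proof.
elim: n => [|n IH]; first by rewrite leqn0 => /eqP ->.
rewrite leq_eqVlt => /orP[/eqP -> //|lt_j]; rewrite /= nth_rcons size_inv_sigmas.
by rewrite lt_j IH.
Qed.

Lemma inv_sigmaP n :
  \sum_(j < n.+1) inv_sigma j * sigma (n - j) = (n == 0)%:R.
Proof.
case: n => [|n]; first by rewrite big_ord1 mul1r.
rewrite big_ord_recr /= subnn mulr1 {2}/inv_sigma /= nth_rcons size_inv_sigmas.
rewrite ltnn eqxx; apply/eqP; rewrite subr_eq0; apply/eqP.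
by apply: eq_bigr => j _; rewrite nth_inv_sigmas // -ltnS.
Qed.

Definition antipodeS : S -> S := peval (fun a => a%:A) (fun i => inv_sigma i.+1).

Lemma amorph_antipodeS : amorph (prod_alg S) (prod_alg S) antipodeS.
Proof. exact: amorph_peval_alg. Qed.

Lemma antipodeS_sigma n : antipodeS (sigma n) = inv_sigma n.
Proof.
case: n => [|n]; last by rewrite /antipodeS peval_var // scale1r.
by have [_ -> _] := amorph_antipodeS.
Qed.

Lemma coassocS f : tassoc (tmap comulS id (comulS f)) = tmap id comulS (comulS f).
Proof.
have hD := amorph_comulS; have hI := @amorph_id K S (prod_alg S).
have [lD _ _] := hD; have lI := @lin_id K S.
move: f; apply: (amorph_sym_ext
    (Q := prod_tens (prod_alg S) (prod_tens (prod_alg S) (prod_alg S)))).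
- exact: (amorph_comp (amorph_tassoc _ _ _) (amorph_comp (amorph_tmap hD hI) hD)).
- exact: (amorph_comp (amorph_tmap hI hD) hD).
move=> n; rewrite comulS_sigma (lin_sum (tmap_linear lD lI)).
rewrite (lin_sum (tmap_linear lI lD)) (lin_sum (@tassoc_linear _ _ _ _)).
pose G k j := tens (sigma k) (tens (sigma (j - k)) (sigma (n - j))).
transitivity (\sum_(j < n.+1) \sum_(k < j.+1) G k j).
  apply: eq_bigr => j _; rewrite tmap_tens // comulS_sigma.
  rewrite (bilin_suml (@tens_bilin _ _ _)) (lin_sum (@tassoc_linear _ _ _ _)).
  by apply: eq_bigr => k _; rewrite tassoc_tens.
rewrite triangle_sum; apply: eq_bigr => k _; rewrite tmap_tens // comulS_sigma.
rewrite (bilin_sumr (@tens_bilin _ _ _)); apply: eq_bigr => l _.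
by rewrite /G addKn subnDA.
Qed.

Lemma scale_bilin (A : comAlgType K) (e : A -> K) : scalar e ->
  bilin (fun u v : A => e u *: v).
Proof.
move=> he; split=> [v a u u' | u a v v'] /=.
  by rewrite he scalerDl scalerA.
by rewrite scalerDr !scalerA mulrC.
Qed.

Lemma scale_bilin_r (A : comAlgType K) (e : A -> K) : scalar e ->
  bilin (fun u v : A => e v *: u).
Proof. by move/scale_bilin => [h1 h2]; split. Qed.

Lemma counitlS f : tlift (fun u v => counitS u *: v) (comulS f) = f.
Proof.
have [le e1 eM] := amorph_counitS; have hb := scale_bilin le.
move: f; apply: (amorph_sym_ext (Q := prod_alg S)).
- apply: amorph_comp amorph_comulS; apply: amorph_tlift => //.
    by rewrite e1 scale1r.
  by move=> a b c d; rewrite eM /= -scalerAr -scalerAl scalerA mulrC.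
- exact: amorph_id.
move=> n; rewrite comulS_sigma (lin_sum (tlift_linear hb)) big_ord_recl.
rewrite big1 ?addr0 => [|j _]; rewrite tlift_tens // counitS_sigma ?scale0r //.
by rewrite scale1r subn0.
Qed.

Lemma counitrS f : tlift (fun u v => counitS v *: u) (comulS f) = f.
Proof.
have [le e1 eM] := amorph_counitS; have hb := scale_bilin_r le.
move: f; apply: (amorph_sym_ext (Q := prod_alg S)).
- apply: amorph_comp amorph_comulS; apply: amorph_tlift => //.
    by rewrite e1 scale1r.
  by move=> a b c d; rewrite eM /= -scalerAr -scalerAl scalerA mulrC.
- exact: amorph_id.
move=> n; rewrite comulS_sigma (lin_sum (tlift_linear hb)) big_ord_recr.
rewrite big1 => [|j _]; rewrite tlift_tens // counitS_sigma.
  by rewrite subnn scale1r /= add0r.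
by rewrite /= subn_eq0 leqNgt ltn_ord scale0r.
Qed.

Lemma antipodeSP : is_antipode comulS counitS antipodeS.
Proof.
have [lS S1 SM] := amorph_antipodeS; have lI := @lin_id K S.
have [le e1 eM] := amorph_counitS.
have he : amorph (prod_alg S) (prod_alg S) (fun f => (counitS f)%:A).
  split; first by move=> a f g; rewrite le scalerDl scalerA.
    by rewrite e1 scale1r.
  by move=> f g; rewrite eM /= mulr_algl scalerA.
have hconv (F G : S -> S) : amorph (prod_alg S) (prod_alg S) F ->
    amorph (prod_alg S) (prod_alg S) G ->
    amorph (prod_alg S) (prod_alg S) (fun f => tlift (fun u v => F u * G v) (comulS f)).
  move=> [lF F1 FM] [lG G1 GM].
  apply: amorph_comp amorph_comulS; apply: amorph_tlift.
  - exact: convol_bilin.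
  - by rewrite F1 G1 /= mulr1.
  - by move=> a b c d; rewrite FM GM; apply: mulrACA.
split; first exact: lS.
- apply: (amorph_sym_ext (hconv _ _ amorph_antipodeS (amorph_id _)) he) => n.
  have hb := convol_bilin lS lI.
  rewrite comulS_sigma (lin_sum (tlift_linear hb)) counitS_sigma scaler_nat.
  rewrite -inv_sigmaP; apply: eq_bigr => j _.
  by rewrite (tlift_tens _ _ hb) antipodeS_sigma.
apply: (amorph_sym_ext (hconv _ _ (amorph_id _) amorph_antipodeS) he) => n.
have hb := convol_bilin lI lS.
rewrite comulS_sigma (lin_sum (tlift_linear hb)) counitS_sigma scaler_nat.
rewrite -inv_sigmaP (reindex_inj rev_ord_inj); apply: eq_bigr => j _ /=.
by rewrite (tlift_tens _ _ hb) antipodeS_sigma subSS mulrC subKn // -ltnS.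
Qed.

Lemma comulS_linear : linear comulS.
Proof. by case: amorph_comulS. Qed.

Lemma counitS_scalar : scalar counitS.
Proof. by case: amorph_counitS. Qed.

Lemma counitS_monoid : monoid_morphism counitS.
Proof. by case: amorph_counitS. Qed.

Definition hopf_Sym : hopfAlgebra S :=
  HopfAlgebra comulS_linear comulS_monoid counitS_scalar counitS_monoid
    coassocS counitlS counitrS antipodeSP.

Lemma hopf_Sym_structure : sym_structure hopf_Sym.
Proof.
have hE P := amorph_peval_id (fun i => (P : G0 K) i.+1).
have evalE (P : G0 K) n : evalG (sigma n) P = P n.
  case: n => [|n]; last by rewrite /evalG peval_var.
  by have [_ e1 _] := hE P; rewrite [LHS]e1 coefG0.
move=> f P Q; have [lP P1 PM] := hE P; have [lQ Q1 QM] := hE Q.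
have hb : bilin (fun g h => evalG g P * evalG h Q : K^o).
  exact: (bilin_comp (@lin_id K K^o) (@alg_mul_bilin K K^o) lP lQ).
have hL : amorph (prod_tens (prod_alg S) (prod_alg S)) (prod_alg K^o)
    (tlift (fun g h => evalG g P * evalG h Q : K^o)).
  apply: (amorph_tlift (R := prod_alg K^o) hb).
    by rewrite [evalG _ _]P1 [evalG _ _]Q1 /= mulr1.
  move=> a b c d; exact: etrans (congr2 *%R (PM a c) (QM b d)) (mulrACA _ _ _ _).
apply: (amorph_sym_ext (Q := prod_alg K^o) (amorph_comp hL amorph_comulS)
  (hE (mulG0 P Q))) f.
move=> n; rewrite comulS_sigma (lin_sum (tlift_linear hb)).
apply: etrans (esym (evalE (mulG0 P Q) n)).
by apply: eq_bigr => j _; rewrite (tlift_tens _ _ hb); congr (_ * _); apply: evalE.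
Qed.
End SymHopf.

(** * The coproduct of a path tree *)

Section PathTrees.
Local Open Scope nat_scope.

(** The chord joining the endpoints of side i in the polygon of degree n.  The
    remainder makes i = n, where the side ends in the root, a uniform case. *)
Definition path_chord n i : chord := (minn i (i.+1 %% n.+1), maxn i (i.+1 %% n.+1)).

Lemma path_chord_lt n i : i < n -> path_chord n i = (i, i.+1).
Proof.
move=> lt_i; rewrite /path_chord modn_small ?ltnS //.
by rewrite (minn_idPl (leqnSn i)) (maxn_idPr (leqnSn i)).
Qed.

Lemma path_chord_last n : path_chord n n = (0, n).
Proof. by rewrite /path_chord modnn minn0 maxn0. Qed.

Lemma path_chordsP n c :
  reflect (exists2 i, 0 < i <= n & c = path_chord n i) (c \in path_chords n).
Proof.
case: n => [|n]; first by apply: (iffP idP) => // -[i]; lia.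
rewrite !inE; apply: (iffP orP) => [[/eqP -> | /imfsetP[i /= hi ->]] | [i hi ->]].
- by exists n.+1; rewrite ?path_chord_last //; lia.
- move: hi; rewrite mem_iota => hi.
  by exists i; rewrite ?path_chord_lt //; lia.
have [lt_i|ge_i] := ltnP i n.+1; last first.
  by left; have -> : i = n.+1 by [lia]; rewrite path_chord_last.
by right; rewrite path_chord_lt //; apply/imfsetP; exists i; rewrite //= mem_iota; lia.
Qed.

Lemma path_chordsE n : path_chords n = [fset path_chord n i | i in iota 1 n].
Proof.
apply/fsetP => c; apply/path_chordsP/imfsetP => -[i /= hi ->]; exists i => //.
  by rewrite mem_iota add1n ltnS.
by move: hi; rewrite mem_iota add1n ltnS.
Qed.

Lemma path_chord_inj n : {in [pred i | 0 < i <= n] &, injective (path_chord n)}.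
Proof.
move=> i j; rewrite !inE => hi hj.
have [lt_i|ge_i] := ltnP i n; have [lt_j|ge_j] := ltnP j n.
- by rewrite !path_chord_lt // => -[].
- have -> : j = n by lia.
  by rewrite (path_chord_lt lt_i) path_chord_last => -[]; lia.
- have -> : i = n by lia.
  by rewrite (path_chord_lt lt_j) path_chord_last => -[]; lia.
lia.
Qed.

Lemma card_path_chord n (s : seq nat) : uniq s -> {subset s <= [pred i | 0 < i <= n]} ->
  #|` [fset path_chord n i | i in s]| = size s.
Proof.
move=> us hs; rewrite card_in_imfset /=; last first.
  by move=> i j /hs hi /hs hj; apply: path_chord_inj.
by rewrite undup_id.
Qed.

Lemma card_path_chords n : #|` path_chords n| = n.
Proof.
rewrite path_chordsE card_path_chord ?iota_uniq ?size_iota // => i.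
by rewrite mem_iota inE add1n ltnS.
Qed.

(** The number of selected sides before vertex v: up to the identification of the
    last vertex with the root, this is the image of v when the polygon is
    contracted onto the sides selected by P. *)
Definition rank (P : pred nat) v := count P (iota 0 v).

Lemma iota_rcons v : iota 0 v.+1 = rcons (iota 0 v) v.
Proof. by rewrite -addn1 iotaD cats1. Qed.

Lemma rankS P v : rank P v.+1 = rank P v + P v.
Proof. by rewrite /rank iota_rcons -cats1 count_cat /= addn0. Qed.

Lemma count_lt_filter P n v : v <= n ->
  count (fun t => t < v) [seq j <- iota 0 n | P j] = rank P v.
Proof.
move=> le_v; rewrite count_filter -(subnKC le_v) iotaD count_cat add0n.
rewrite [X in _ + X](eq_in_count (a2 := pred0)) ?count_pred0 ?addn0; last first.
  by move=> t; rewrite mem_iota /=; lia.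
by apply: eq_in_count => t; rewrite mem_iota /=; lia.
Qed.

(** Each selected side raises the rank by one and the others leave it unchanged. *)
Lemma map_rank P n :
  [seq rank P j | j <- iota 0 n & P j] = iota 0 (rank P n).
Proof.
elim: n => [//|n IH]; rewrite rankS [in LHS]iota_rcons filter_rcons.
case: (P n); rewrite ?addn0 // map_rcons IH addn1.
by rewrite iota_rcons.
Qed.

(** T is a set of sides containing side 0, and T' the sides of T that carry a
    chord of the path tree; m is the degree of the contracted tree. *)
Section Restriction.
Variables (n : nat) (P : pred nat).
Hypothesis P0 : P 0.
Let T := [seq j <- iota 0 n.+1 | P j].
Let T' := [seq j <- iota 1 n | P j].
Let m := size T'.

Lemma restr_cons : T = 0 :: T'.
Proof. by rewrite /T /= P0. Qed.

Lemma rank_total : rank P n.+1 = m.+1.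
Proof. by rewrite /rank -size_filter -/T restr_cons. Qed.

Lemma map_rank_pos : [seq rank P j | j <- T'] = iota 1 m.
Proof.
have := map_rank P n.+1; rewrite -/T restr_cons rank_total /=.
by move=> [].
Qed.

Lemma rank_in j : j \in T' -> 0 < rank P j <= m.
Proof.
by move=> /(map_f (rank P)); rewrite map_rank_pos mem_iota add1n ltnS.
Qed.

Lemma contract_vertex_rank v : v <= n.+1 -> contract_vertex T v = rank P v %% m.+1.
Proof. by move=> le_v; rewrite /contract_vertex count_lt_filter // restr_cons. Qed.

(** The vertex n + 1 is the root 0; it has as many sides of T before it as T has,
    which is 0 modulo the size of T. *)
Lemma contract_vertex_mod v : v <= n.+1 ->
  contract_vertex T (v %% n.+1) = rank P v %% m.+1.
Proof.
rewrite leq_eqVlt => /orP[/eqP ->|lt_v].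
  by rewrite modnn contract_vertex_rank // rank_total modnn mod0n.
by rewrite modn_small // contract_vertex_rank // ltnW.
Qed.

Lemma contract_vertex_in j : j \in T' -> contract_vertex T j = rank P j.
Proof.
move=> hj; have := rank_in hj; move: hj; rewrite mem_filter mem_iota => hj hr.
by rewrite contract_vertex_rank; [rewrite modn_small //; lia | lia].
Qed.

Lemma contract_vertex_next j : j \in T' ->
  contract_vertex T (j.+1 %% n.+1) = (rank P j).+1 %% m.+1.
Proof.
rewrite mem_filter mem_iota => /andP[Pj hj].
by rewrite contract_vertex_mod; [rewrite rankS Pj addn1 | lia].
Qed.

(** The endpoints of side j go to the endpoints of its image, as side j itself is
    not contracted. *)
Lemma contract_path_chord j : j \in T' ->
  contract_chord T (path_chord n j) = path_chord m (rank P j).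
Proof.
move=> hj; rewrite /path_chord -(contract_vertex_next hj) -(contract_vertex_in hj).
rewrite /contract_chord; move: (j.+1 %% n.+1) => v.
by case: (leqP j v) => _ //=; rewrite minnC maxnC.
Qed.

(** The path trees are stable under contraction onto a set of sides containing
    side 0: both factors of the coproduct are instances of this. *)
Lemma contract_path :
  contract T [fset path_chord n i | i in T'] = path_chords m.
Proof.
rewrite path_chordsE -map_rank_pos; apply/fsetP => c.
apply/imfsetP/imfsetP => /=.
  move=> [d /imfsetP[/= j hj ->] ->]; exists (rank P j); first exact: map_f.
  exact: contract_path_chord.
move=> [k /mapP[j hj ->] ->]; exists (path_chord n j).
  by apply/imfsetP; exists j.
by rewrite contract_path_chord.
Qed.
End Restriction.

Lemma adj_sym D : symmetric (adj D).
Proof. by move=> i j; rewrite /adj orbC. Qed.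

Lemma path_adjP n i j : 
  reflect (exists2 k, 0 < k <= n & (i, j) = (k, k.+1 %% n.+1) \/ (j, i) = (k, k.+1 %% n.+1))
   (adj (path_chords n) i j).
Proof.
have chordE k : path_chord n k = (k, k.+1 %% n.+1) \/
    path_chord n k = (k.+1 %% n.+1, k).
  rewrite /path_chord; move: (k.+1 %% n.+1) => v.
  by case: (leqP k v); [left | right].
apply: (iffP orP) => [[]/path_chordsP[k hk e]|[k hk []]].
- by exists k => //; case: (chordE k) e => -> [-> ->]; [left|right].
- by exists k => //; case: (chordE k) e => -> [-> ->]; [right|left].
- move=> [-> ->]; case: (chordE k) => e; [left|right].
    by apply/path_chordsP; exists k.
  by apply/path_chordsP; exists k.
move=> [-> ->]; case: (chordE k) => e; [right|left].
  by apply/path_chordsP; exists k.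
by apply/path_chordsP; exists k.
Qed.

(** The position of a vertex along the path 1, 2, .., n, 0. *)
Definition path_pos n v := if v == 0 then n.+1 else v.

Lemma adj_le n u v : adj (path_chords n) u v ->
  path_pos n v <= path_pos n u -> v = (path_pos n u).-1.
Proof.
move=> /path_adjP[k hk]; have k0 : (k == 0) = false by lia.
have [lt_k|ge_k] := ltnP k n.
  by rewrite modn_small ?ltnS // => -[] [-> ->]; rewrite /path_pos /= ?k0; lia.
have ek : k = n by lia.
by rewrite -ek modnn => -[] [-> ->]; rewrite /path_pos /= ?k0; lia.
Qed.

Lemma seq_argmax (f : nat -> nat) (s : seq nat) : s != [::] ->
  exists2 u, u \in s & {in s, forall v, f v <= f u}.
Proof.
elim: s => // x [|y s] IH _; first by exists x; rewrite ?mem_head // => v /[!inE] /eqP->.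
have [//|u us hu] := IH; have [le_ux|/ltnW le_xu] := leqP (f u) (f x).
  exists x; first exact: mem_head.
  by move=> v; rewrite inE => /orP[/eqP-> //|/hu h]; apply: leq_trans le_ux.
exists u; first by rewrite inE us orbT.
by move=> v; rewrite inE => /orP[/eqP-> //|/hu].
Qed.

(** The vertex of a cycle that is farthest along the path 1, .., n, 0 would have
    two distinct neighbours before it, whereas only its predecessor is one. *)
Lemma path_chords_acyclic n : acyclic (path_chords n).
Proof.
move=> s us size_s; apply/negP => cyc.
have s0 : s != [::] by case: (s) size_s.
have [u uin umax] := seq_argmax (path_pos n) s0.
have [i [|a t] Es] := rot_to uin.
  by move: size_s; rewrite -(size_rot i) Es.
have t0 : t != [::] by move: size_s; rewrite -(size_rot i) Es; case: (t).
have: cycle (adj (path_chords n)) (rot i s) by rewrite rot_cycle.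
rewrite Es /= rcons_path => /and3P[ua _ bu].
have inS v : v \in a :: t -> path_pos n v <= path_pos n u.
  by move=> hv; apply: umax; rewrite -(mem_rot i) Es inE hv orbT.
have ea := adj_le ua (inS _ (mem_head _ _)).
rewrite adj_sym in bu; have eb := adj_le bu (inS _ (mem_last _ _)).
move: us; rewrite -(rot_uniq i) Es /= => /and3P[_ /negP[]].
by rewrite ea -eb; case: (t) t0 => //= b r _; rewrite mem_last.
Qed.

Lemma dissection_path n : dissection (path_chords n).
Proof.
have bounds i : 0 < i <= n -> (path_chord n i).1 < (path_chord n i).2 <= n.
  move=> hi; have [lt_i|ge_i] := ltnP i n; first by rewrite path_chord_lt /=; lia.
  by have -> : i = n by [lia]; rewrite path_chord_last /=; lia.
split; last exact: path_chords_acyclic.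
  by move=> c /path_chordsP[i hi ->]; rewrite card_path_chords bounds.
move=> c d /path_chordsP[i hi ->] /path_chordsP[j hj ->]; have := bounds j hj.
rewrite /crossing; have [lt_i|ge_i] := ltnP i n; first by rewrite (path_chord_lt lt_i) /=; lia.
by have -> : i = n by [lia]; rewrite path_chord_last /=; lia.
Qed.

(** The path from k to the root visits k, k + 1, .., n and then 0. *)
Lemma towards_path n k : 0 < k <= n -> towards (path_chords n) k (k.+1 %% n.+1).
Proof.
move=> hk; apply/asboolP; pose p := rcons (iota k.+1 (n - k)) 0.
have Ep : p = k.+1 %% n.+1 :: behead p.
  rewrite /p; have [lt_k|ge_k] := ltnP k n.
    by rewrite modn_small //; have -> : n - k = (n - k.+1).+1 by lia.
  have -> : k = n by lia.
  by rewrite subnn modnn.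
exists (behead p); rewrite -Ep; split.
- rewrite /p; have [d Ed] : exists d, d = n - k by eexists.
  elim: d k hk {p Ep} Ed => [|d IH] k hk Ed; rewrite -Ed /= ?andbT.
    by apply/path_adjP; exists k => //; left; have -> : k = n by [lia]; rewrite modnn.
  have := IH k.+1; have <- : d = n - k.+1 by lia.
  move=> -> //; last by lia.
  rewrite andbT; apply/path_adjP; exists k => //; left.
  by rewrite modn_small //; lia.
- by rewrite /= mem_rcons rcons_uniq inE !mem_iota iota_uniq /=; lia.
by rewrite -[LHS]/(last k (k.+1 %% n.+1 :: behead p)) -Ep /p last_rcons.
Qed.

(** A simple path from the root ends at the root only if it is empty. *)
Lemma towards_root D b : towards D 0 b = false.
Proof.
apply/asboolP => -[s [_ /= /andP[h0 _] e]].
by move: h0; rewrite -{1}e mem_last.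
Qed.

Section Cut.
Variables (n : nat) (C : chords).
Hypothesis CD : C `<=` path_chords n.

(** The side i is cut off by its chord when this chord belongs to C; side 0 has no
    chord. *)
Definition cut i := (0 < i) && (path_chord n i \in C).
Arguments cut : simpl never.

Lemma cutP c : reflect (exists2 i, (i <= n) && cut i & c = path_chord n i) (c \in C).
Proof.
apply: (iffP idP) => [cC|[i /and3P[_ _ iC] -> //]].
have /path_chordsP[i hi e] := fsubsetP CD c cC.
by exists i; rewrite // /cut -e cC; lia.
Qed.

(** The chord of side i < n has side i alone inside; the chord {0, n} of side n has
    all the other sides inside and side n outside. *)
Lemma cuts_off_path i k : 0 < i <= n -> k <= n ->
  cuts_off (path_chord n i) k = ((i == n) (+) (i == k)).
Proof.
move=> hi hk; rewrite /cuts_off; have [lt_i|ge_i] := ltnP i n.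
  by rewrite path_chord_lt //=; lia.
by have -> : i = n by [lia]; rewrite path_chord_last /= eqxx; lia.
Qed.

Lemma inside_path i j : 0 < i <= n -> 0 < j <= n ->
  ((path_chord n i).1 <= (path_chord n j).1) &&
    ((path_chord n j).2 <= (path_chord n i).2) = (i == n) || (i == j).
Proof.
move=> hi hj; have [lt_i|ge_i] := ltnP i n; have [lt_j|ge_j] := ltnP j n.
- by rewrite (path_chord_lt lt_i) (path_chord_lt lt_j) /=; lia.
- have -> : j = n by lia.
  by rewrite (path_chord_lt lt_i) path_chord_last /=; lia.
- have -> : i = n by lia.
  by rewrite (path_chord_lt lt_j) path_chord_last /= eqxx; lia.
have -> : i = n by lia.
have -> : j = n by lia.
by rewrite path_chord_last /= eqxx; lia.
Qed.

Lemma same_face_path j k : j <= n -> k <= n ->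
  same_face C j k = (j == k) || ~~ cut j && ~~ cut k.
Proof.
move=> hj hk; apply/allP/idP => [h|h c /cutP[i hi ->]]; last first.
  have [hin ci] := andP hi; have i0 : 0 < i by case/andP: ci.
  rewrite !cuts_off_path ?i0 //; suff -> : (i == j) = (i == k) by [].
  case/orP: h => [/eqP-> // | /andP[cj ck]].
  rewrite (_ : (i == j) = false); first by apply/esym; apply: contraNF ck => /eqP <-.
  by apply: contraNF cj => /eqP <-.
case: eqVneq => //= njk; apply/andP; split; apply/negP => hc.
  have [j0 /h] := andP hc; rewrite !cuts_off_path ?j0 //.
  by rewrite eqxx (negbTE njk); case: (j == n).
have [k0 /h] := andP hc; rewrite !cuts_off_path ?k0 //.
by rewrite eqxx [k == j]eq_sym (negbTE njk); case: (k == n).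
Qed.

Lemma face_sides_cut i : i <= n -> cut i -> face_sides n C i = [:: i].
Proof.
move=> hi ci; rewrite /face_sides.
rewrite (eq_in_filter (a2 := pred1 i)); last first.
  by move=> k; rewrite mem_iota => hk; rewrite same_face_path /=; lia.
by rewrite filter_pred1_uniq ?iota_uniq // mem_iota; lia.
Qed.

Lemma face_sides_uncut i : i <= n -> ~~ cut i ->
  face_sides n C i = [seq j <- iota 0 n.+1 | ~~ cut j].
Proof.
move=> hi ci; apply: eq_in_filter => k; rewrite mem_iota => hk.
rewrite same_face_path // ci; case: eqVneq => //= <-.
by rewrite ci.
Qed.

Lemma min_sides_path : min_sides n C = 0 :: [seq i <- iota 1 n | cut i].
Proof.
transitivity [seq i <- iota 0 n.+1 | (i == 0) || cut i].
  apply: eq_in_filter => i; rewrite mem_iota => hi.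
  have {}hi : i <= n by lia.
  case ci: (cut i); first by rewrite face_sides_cut //= eqxx orbT.
  by rewrite face_sides_uncut ?ci //= eq_sym orbF.
rewrite /=; congr (_ :: _); apply: eq_in_filter => i; rewrite mem_iota => hi.
by case: i hi.
Qed.

Lemma cut_chords : C = [fset path_chord n i | i in [seq i <- iota 1 n | cut i]].
Proof.
apply/fsetP => c; apply/cutP/imfsetP => -[i /= hi ->]; exists i => //.
  by move: hi; rewrite mem_filter mem_iota /cut; lia.
by move: hi; rewrite mem_filter mem_iota; lia.
Qed.

Lemma card_cut : #|` C| = size [seq i <- iota 1 n | cut i].
Proof.
rewrite [X in #|` X|]cut_chords card_path_chord ?filter_uniq ?iota_uniq // => i.
by rewrite mem_filter mem_iota inE; lia.
Qed.

Lemma card_uncut : size [seq i <- iota 1 n | ~~ cut i] = n - #|` C|.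
Proof.
rewrite card_cut !size_filter -{2}(size_iota 1 n).
by rewrite -(count_predC cut) addKn.
Qed.

(** Each face {i} has minimal side i and the remaining face has minimal side 0, so
    that T consists of 0 and of the sides of the chords in C. *)
Lemma r_diag_path : r_diag C (path_chords n) = path_chords #|` C|.
Proof.
rewrite /r_diag card_path_chords min_sides_path card_cut [X in contract _ X]cut_chords.
pose P i := (i == 0) || cut i.
have eP : [seq i <- iota 1 n | cut i] = [seq i <- iota 1 n | P i].
  by apply: eq_in_filter => i; rewrite mem_iota /P; case: i.
by rewrite eP -(contract_path n (P := P)) // restr_cons.
Qed.

(** The chords outside C all lie in the face of side 0, since the other faces have
    a single side. *)
Lemma q_face_root : q_face C (path_chords n) 0 = path_chords (n - #|` C|).
Proof.
rewrite /q_face card_path_chords face_sides_uncut //.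
rewrite -card_uncut -(contract_path n (P := fun i => ~~ cut i)) //.
congr contract; apply/fsetP => c; rewrite !inE.
apply/and3P/imfsetP => [[/path_chordsP[j hj ->] jC _]|[j /= hj ->]].
  by exists j; rewrite //= mem_filter mem_iota /cut negb_and jC orbT; lia.
move: hj; rewrite mem_filter mem_iota => /andP[cj hj].
have jC : path_chord n j \notin C by move: cj; rewrite /cut; case: (j) hj.
split=> //; first by apply/path_chordsP; exists j => //; lia.
apply/allP => d /cutP[i /and3P[hi i0 iC] ->].
rewrite cuts_off_path ?i0 // inside_path ?i0 //.
have -> : (i == j) = false by apply: contraNF jC => /eqP <-.
by rewrite orbF eqn0Ngt i0 addbF.
Qed.

Lemma q_face_cut i : i <= n -> cut i -> q_face C (path_chords n) i = fset0.
Proof.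
move=> hi ci; rewrite /q_face [X in contract _ X](_ : _ = fset0).
  by apply/fsetP => c; rewrite inE; apply/imfsetP => -[d].
apply/fsetP => c; rewrite !inE; apply/and3P => -[/path_chordsP[j hj ->] jC].
have /andP[i0 iC] := ci.
move=> /allP/(_ _ iC); rewrite cuts_off_path ?i0 // inside_path ?i0 // eqxx.
have -> : (i == j) = false by apply: contraNF jC => /eqP <-.
by rewrite orbF; case: (i == n).
Qed.

(** In a path tree every chord is oriented from the start of its side to the end of
    its side, and contraction respects starts and ends of sides. *)
Lemma k_diag_path : k_diag C (path_chords n) = 0.
Proof.
rewrite /k_diag card_path_chords r_diag_path; apply/eqP; rewrite cardfs_eq0.
apply/eqP/fsetP => c; rewrite !inE; apply/andP => -[cC /negP[]].
have {cC} : c \in C := cC.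
rewrite [X in _ \in X]cut_chords => /imfsetP[j /= hj ->]; pose P i := (i == 0) || cut i.
have eP : [seq i <- iota 1 n | cut i] = [seq i <- iota 1 n | P i].
  by apply: eq_in_filter => i; rewrite mem_iota /P; case: i.
have hj' : 0 < j <= n by move: hj; rewrite mem_filter mem_iota; lia.
rewrite min_sides_path eP -(@restr_cons n P) // card_cut eP.
have [lt_j|ge_j] := ltnP j n; last first.
  (* The chord {0, n} is listed from the root, and contraction fixes the root. *)
  have -> : j = n by lia.
  rewrite path_chord_last [(0, n).1]/= contract_vertex_rank // [rank P 0]/= mod0n.
  by rewrite !towards_root.
rewrite (path_chord_lt lt_j) [(j, j.+1).1]/= [(j, j.+1).2]/=.
rewrite -(modn_small (_ : j.+1 < n.+1)) //; rewrite eP in hj; have P0 : P 0 by [].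
rewrite towards_path // (contract_vertex_in P0 hj) (contract_vertex_next P0 hj).
by rewrite towards_path // (rank_in P0 hj).
Qed.
End Cut.
End PathTrees.

Lemma path_chords_eq0 n : (path_chords n == fset0) = (n == 0%N).
Proof. by rewrite -cardfs_eq0 card_path_chords. Qed.

Lemma coproduct_term (K : fieldType) (x : K) n C : C `<=` path_chords n ->
  x ^+ k_diag C (path_chords n) *:
    tens (q_prod K C (path_chords n)) (dclass K (r_diag C (path_chords n))) =
  tens (pathY K (n - #|` C|)) (pathY K #|` C|).
Proof.
move=> CD; rewrite k_diag_path // expr0 scale1r r_diag_path //.
rewrite /q_prod card_path_chords min_sides_path // big_cons q_face_root //.
rewrite big1_seq ?mulr1 // => i /andP[_]; rewrite mem_filter mem_iota => /andP[ci hi].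
by rewrite q_face_cut //; lia.
Qed.

Lemma sum_fpowerset (V : nmodType) (T : choiceType) (A : {fset T}) (F : nat -> V) :
  \sum_(B <- fpowerset A) F #|` B| = \sum_(k < #|` A|.+1) F k *+ 'C(#|` A|, k).
Proof.
rewrite /fpowerset big_imfset /=; last first.
  by move=> X Y _ _ /fsetP e; apply/setP => y; have := e (val y); rewrite !inE.
rewrite big_enum /= (eq_big predT (fun Y : {set A} => F #|Y|)); first last.
- by move=> Y _; rewrite card_imfset /= -?cardE //; apply: val_inj.
- by move=> Y; rewrite powersetE subsetT.
have card_lt (Y : {set A}) : (#|Y| < #|` A|.+1)%N.
  by rewrite ltnS cardfE max_card.
rewrite (partition_big (fun Y : {set A} => Ordinal (card_lt Y)) predT) //=.
apply: eq_bigr => k _.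
rewrite (eq_bigr (fun=> F k)) => [|Y /eqP <- //]; rewrite sumr_const.
congr (_ *+ _); rewrite [X in _ = binomial X _]cardfE -card_draws; apply: eq_card => Y.
by rewrite !inE.
Qed.

Lemma coproduct_path (K : fieldType) (x : K) n :
  coproduct_gen x (path_chords n) =
  \sum_(k < n.+1) tens (pathY K (n - k)) (pathY K k) *+ 'C(n, k).
Proof.
transitivity (\sum_(C <- fpowerset (path_chords n))
    tens (pathY K (n - #|` C|)) (pathY K #|` C|)).
  apply: eq_big_seq => C; rewrite fpowersetE; exact: coproduct_term.
rewrite (sum_fpowerset _ (fun k => tens (pathY K (n - k)) (pathY K k))).
by rewrite card_path_chords.
Qed.

(** * The isomorphism between path trees and Sym *)

Section PathTreeAlgebra.
Variable K : fieldType.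
Local Notation H := (HD K).
Local Notation S := (Sym K).

Lemma pathY0 : pathY K 0 = 1.
Proof. by rewrite /pathY /dclass eqxx. Qed.

(** For n >= 1 the set of chords path_chords n is a diagram, so the class of Y_n is
    a variable and not the default value 0. *)
Lemma pathY_var n : {d : diagram | val d = path_chords n.+1 & pathY K n.+1 = pvar K d}.
Proof.
have pd : `[< dissection (path_chords n.+1) >] && (path_chords n.+1 != fset0).
  by rewrite path_chords_eq0 andbT; apply/asboolP/dissection_path.
exists (Sub (path_chords n.+1) pd) => //.
by rewrite /pathY /dclass path_chords_eq0 /= insubT.
Qed.

(** In characteristic 0, a left inverse of Sigma_n |-> Y_n/n!, which spares a discussion of
    the linear independence of monomials in the Y_n. *)
Definition to_sym : H -> S :=
  peval (fun a => a%:A) (fun d : diagram =>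
    let D := val d in
    if D == path_chords #|` D| then (#|` D|)`!%:R *: sigma K #|` D| else 0).

Lemma amorph_to_sym : amorph (prod_alg H) (prod_alg S) to_sym.
Proof. exact: amorph_peval_alg. Qed.

Lemma to_sym_path n : to_sym (pathY K n) = n`!%:R *: sigma K n.
Proof.
case: n => [|n].
  by rewrite pathY0 fact0 scale1r; have [_ h1 _] := amorph_to_sym; exact: h1.
have [d ed ->] := pathY_var n; rewrite /to_sym peval_var ?scale1r //= ed.
by rewrite card_path_chords eqxx.
Qed.

Definition of_sym : S -> H :=
  peval (fun a => a%:A) (fun i => (i.+1)`!%:R^-1 *: pathY K i.+1).

Lemma amorph_of_sym : amorph (prod_alg S) (prod_alg H) of_sym.
Proof. exact: amorph_peval_alg. Qed.

Lemma of_sym_sigma n : of_sym (sigma K n) = n`!%:R^-1 *: pathY K n.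
Proof.
case: n => [|n]; last by rewrite /of_sym peval_var ?scale1r.
by rewrite pathY0 invr1 scale1r; have [_ h1 _] := amorph_of_sym; exact: h1.
Qed.

Lemma pathY_in n : pathY K n \in @EY_pred K.
Proof.
apply/asboolP; exists [:: (1, [:: n])].
by rewrite !big_seq1 scale1r.
Qed.

Lemma of_sym_in f : of_sym f \in @EY_pred K.
Proof.
rewrite /of_sym /peval rpred_sum // => m _; rewrite rpredM ?rpredZ ?rpred1 //.
by apply: rpred_prod => i _; rewrite rpredX // rpredZ // pathY_in.
Qed.

Lemma amorph_counitD : amorph (prod_alg H) (prod_alg K^o) (@counitD K).
Proof.
have [hM h1] := @mcoeff1g_is_multiplicative {cmonom diagram} K.
by split=> // a f g; rewrite /counitD mcoeffD mcoeffZ.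
Qed.

Lemma counitD_path n : counitD (pathY K n) = (n == 0%N)%:R.
Proof.
case: n => [|n]; first by rewrite pathY0; have [_ h1 _] := amorph_counitD; exact: h1.
by have [d _ ->] := pathY_var n; rewrite /counitD mcoeffU cm1_eq1.
Qed.

Lemma counitD_of_sym f : counitD (of_sym f) = counitS f.
Proof.
move: f; apply: (amorph_sym_ext (Q := prod_alg K^o)).
- exact: amorph_comp amorph_counitD amorph_of_sym.
- exact: amorph_counitS.
move=> n; rewrite of_sym_sigma; have [lc _ _] := amorph_counitD.
rewrite (linZ lc) counitD_path counitS_sigma.
by case: n => [|n]; rewrite ?scaler0 // invr1 scale1r.
Qed.

Section Coproduct.
Variable x : K.

Lemma amorph_coproductD :
  amorph (prod_alg H) (prod_tens (prod_alg H) (prod_alg H)) (coproductD x).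
Proof. exact: amorph_peval_tens. Qed.

Lemma coproductD_path n : coproductD x (pathY K n) =
  \sum_(k < n.+1) tens (pathY K (n - k)) (pathY K k) *+ 'C(n, k).
Proof.
case: n => [|n].
  rewrite big_ord1 bin0 mulr1n pathY0.
  by have [_ h1 _] := amorph_coproductD; exact: h1.
rewrite -(coproduct_path x); have [d ed ->] := pathY_var n.
by rewrite -ed; apply: peval_var; exact: scale1r.
Qed.
End Coproduct.

Hypothesis charK : [pchar K] =i pred0.

Lemma fact_neq0 n : n`!%:R != 0 :> K.
Proof. by rewrite ((pcharf0P K).1 charK) -lt0n fact_gt0. Qed.

Lemma of_symK : cancel of_sym to_sym.
Proof.
apply: (amorph_sym_ext (Q := prod_alg S)).
- exact: amorph_comp amorph_to_sym amorph_of_sym.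
- exact: amorph_id.
move=> n; have [lt _ _] := amorph_to_sym.
by rewrite of_sym_sigma (linZ lt) to_sym_path scalerA mulVf ?fact_neq0 ?scale1r.
Qed.

Lemma to_symK f : f \in @EY_pred K -> of_sym (to_sym f) = f.
Proof.
have [lh h1 hM] := amorph_comp amorph_of_sym amorph_to_sym.
have [lo _ _] := amorph_of_sym.
move=> /asboolP[s ->]; rewrite (lin_sum lh); apply: eq_bigr => p _.
rewrite (linZ lh); congr (_ *: _).
rewrite (big_morph (fun g => of_sym (to_sym g)) (op1 := *%R) (id1 := 1) hM h1).
apply: eq_bigr => n _.
by rewrite to_sym_path (linZ lo) of_sym_sigma scalerA mulfV ?fact_neq0 ?scale1r.
Qed.

(** The binomial coefficients of the coproduct of Y_n disappear after division
    by n!. *)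
Lemma comul_of_sym (x : K) f :
  tmap of_sym of_sym (comulS f) = coproductD x (of_sym f).
Proof.
have hP := amorph_of_sym; have [lP _ _] := hP; have [lD _ _] := amorph_coproductD x.
move: f; apply: (amorph_sym_ext (Q := prod_tens (prod_alg H) (prod_alg H))).
- exact: amorph_comp (amorph_tmap hP hP) (amorph_comulS K).
- exact: amorph_comp (amorph_coproductD x) hP.
move=> n; rewrite comulS_sigma of_sym_sigma (linZ lD) coproductD_path.
rewrite (lin_sum (tmap_linear lP lP)) scaler_sumr (reindex_inj rev_ord_inj).
apply: eq_bigr => j _ /=; have le_j : (j <= n)%N by rewrite -ltnS.
rewrite subSS subKn // tmap_tens // !of_sym_sigma.
have hb := @tens_bilin K H H.
rewrite (linZ (hb.1 _)) (linZ (hb.2 _)) scalerA -scaler_nat scalerA.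
apply: (congr1 (fun c : K => c *: tens (pathY K (n - j)) (pathY K j))).
rewrite -(bin_fact le_j) !natrM !invfM.
have bin_neq0 : 'C(n, j)%:R != 0 :> K by rewrite ((pcharf0P K).1 charK) -lt0n bin_gt0.
by rewrite [RHS]mulrAC mulVf // mul1r mulrC.
Qed.

Definition sym_to_EY (f : S) : EY K := (Sub (of_sym f) (of_sym_in f) : EY_type K).
Definition EY_to_sym (a : EY K) : S := to_sym (EY_incl a).

Lemma amorph_EY_incl : amorph (prod_alg (EY K)) (prod_alg H) (@EY_incl K).
Proof. by []. Qed.

Lemma EY_incl_sym_to_EY f : EY_incl (sym_to_EY f) = of_sym f.
Proof. by []. Qed.

Lemma sym_to_EY_linear : linear sym_to_EY.
Proof. by have [h _ _] := amorph_of_sym => a f g; apply: val_inj; exact: h. Qed.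

Lemma sym_to_EY_monoid : monoid_morphism sym_to_EY.
Proof.
have [_ h1 hM] := amorph_of_sym.
by split=> [|f g]; apply: val_inj; [exact: h1 | exact: hM].
Qed.

Lemma amorph_EY_to_sym : amorph (prod_alg (EY K)) (prod_alg S) EY_to_sym.
Proof. exact: amorph_comp amorph_to_sym amorph_EY_incl. Qed.

Lemma EY_to_sym_monoid : monoid_morphism EY_to_sym.
Proof. by have [_ h1 hM] := amorph_EY_to_sym; split. Qed.

Lemma EY_to_sym_linear : linear EY_to_sym.
Proof. by have [h _ _] := amorph_EY_to_sym. Qed.

Definition sym_to_EY_mor : {lrmorphism S -> EY K} :=
  HB.pack sym_to_EY (GRing.isLinear.Build _ _ _ _ _ sym_to_EY_linear)
    (GRing.isMonoidMorphism.Build _ _ _ sym_to_EY_monoid).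

Definition EY_to_sym_mor : {lrmorphism EY K -> S} :=
  HB.pack EY_to_sym (GRing.isLinear.Build _ _ _ _ _ EY_to_sym_linear)
    (GRing.isMonoidMorphism.Build _ _ _ EY_to_sym_monoid).

Lemma sym_to_EYK : cancel sym_to_EY_mor EY_to_sym_mor.
Proof. by move=> f; rewrite -[RHS]of_symK -EY_incl_sym_to_EY. Qed.

Lemma EY_to_symK : cancel EY_to_sym_mor sym_to_EY_mor.
Proof. by move=> a; apply: val_inj; apply: to_symK; exact: (valP (a : EY_type K)). Qed.

Definition hopf_EY : hopfAlgebra (EY K) :=
  hopf_transport (hopf_Sym K) sym_to_EYK EY_to_symK.

Lemma hopf_EY_sub x : hopf_subalgebra x hopf_EY.
Proof.
have [li i1 iM] := amorph_EY_incl.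
have lE := sym_to_EY_linear; have [lo _ _] := amorph_of_sym.
have inclE (a : EY K) : EY_incl a = of_sym (EY_to_sym a).
  by rewrite -{1}(EY_to_symK a).
have comulE (a : EY K) :
    tmap (@EY_incl K) (@EY_incl K) (comul hopf_EY a) = coproductD x (EY_incl a).
  rewrite [comul _ _]/= /comul_tr tmap_comp // inclE -comul_of_sym.
  by congr (tmap _ _ _).
have counitE (a : EY K) : counit hopf_EY a = counitD (EY_incl a).
  by rewrite inclE counitD_of_sym.
split=> // T [lT Tl Tr] a; have [lS _ Sr] := antipodeP hopf_EY; apply/esym.
have hl (b : EY K) : tlift (fun u v => T (EY_incl u) * EY_incl v) (comul hopf_EY b)
    = (counit hopf_EY b)%:A.
  rewrite counitE -Tl -comulE (tlift_tmap _ _ li li) //.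
  exact: (convol_bilin lT (@lin_id K H)).
have hr (b : EY K) :
    tlift (fun u v => EY_incl u * EY_incl (antipode hopf_EY v)) (comul hopf_EY b)
    = (counit hopf_EY b)%:A.
  transitivity (EY_incl (counit hopf_EY b)%:A); last by rewrite (linZ li) [EY_incl 1]i1.
  rewrite -Sr (lin_tlift_comp _ _ li); apply: eq_tlift => u v.
  exact: esym (iM u (antipode hopf_EY v)).
exact: (convol_inverse_unique (lin_comp lT li) li (lin_comp li lS) hl hr).
Qed.
End PathTreeAlgebra.

Theorem proposition4 (K : fieldType) (charK : [pchar K]%R =i pred0) (x : K) :
  exists (HE : hopfAlgebra (EY K)) (HS : hopfAlgebra (Sym K)),
    [/\ hopf_subalgebra x HE, sym_structure HS & hopf_isomorphic HE HS].
Proof.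
exists (hopf_EY charK), (hopf_Sym K); split.
- exact: hopf_EY_sub.
- exact: hopf_Sym_structure.
exact: hopf_transport_isom.
Qed.
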